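(* Let $s>\frac52$ and $f\in C^{[s]+1}(\mathbb{R})$ with $f(0)=0$. Let $\beta\in L^1(\mathbb{R})$ and let $\beta'=\mu$ be a finite measure on $\mathbb{R}$, with point values $\beta(x)=\int_{(-\infty,x]}d\mu$. Let $u\in C^1([0,T],H^s(\mathbb{R}))$ be the solution of the initial-value problem $$u_t+(\beta\ast f(u))_x=0,\quad x\in\mathbb{R},\ t>0,\qquad u(x,0)=\varphi(x),\quad x\in\mathbb{R},$$ with $\varphi\in H^s(\mathbb{R})$. Then for sufficiently small $h>0$ and $\epsilon>0$ there is an $N$ so that the solution $\mathbf{u}_h^N=((\mathbf{u}_h^N)_i)_{-N\le i\le N}$ of the finite system $$\frac{dv_i^N}{dt}=-\sum_{j=-N}^{N}h\,D\beta(x_i-x_j)\,f(v_j^N),\qquad -N\le i\le N,$$ with initial values $(\mathbf{u}_h^N)_i(0)=\varphi(ih)$, $-N\le i\le N$, exists for times $t\in[0,T]$ and $$\big|u(ih,t)-(\mathbf{u}_h^N)_i(t)\big|=\mathcal{O}(h+\epsilon),\qquad t\in[0,T],$$ for all $-N\le i\le N$.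
   Context: All functions are real-valued. $(\beta\ast v)(x)=\int_{\mathbb{R}}\beta(x-y)v(y)\,dy$. $\mu$ is a signed Borel measure and $\beta'$ is the distributional derivative. $H^s(\mathbb{R})$ is the usual $L^2$-based Sobolev space of index $s$ on $\mathbb{R}$ (elements are identified with their continuous representatives), and $[s]$ is the largest integer less than or equal to $s$. Grid points are $x_i=ih$, $i\in\mathbb{Z}$, and $D\beta(x_i-x_j)=\frac{1}{2h}\big(\beta(x_{i-j+1})-\beta(x_{i-j-1})\big)$. The conclusion is read as: there are $h_0,\epsilon_0,C>0$ such that for all $0<h\le h_0$ and $0<\epsilon\le\epsilon_0$ there is a positive integer $N$ (depending on $h$ and $\epsilon$) for which the solution exists on $[0,T]$ and the error is at most $C(h+\epsilon)$, with $C$ independent of $h$, $\epsilon$, $N$, $i$, $t$. *)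

(* Defs.v *)
From HB Require Import structures.
From mathcomp Require Import all_boot all_order all_algebra.
From mathcomp Require Import all_classical all_reals all_analysis.
From mathcomp.real_closed Require Import complex.

Set Implicit Arguments.
Unset Strict Implicit.
Unset Printing Implicit Defensive.

Import Order.TTheory GRing.Theory Num.Theory.
Import numFieldNormedType.Exports.
Import ComplexField.Normc.

Local Open Scope classical_set_scope.
Local Open Scope ring_scope.

Section SobolevSpace.
Context {R : realType}.
Local Notation leb := (@lebesgue_measure R).

Definition L2_norm (u : R -> R) : \bar R := ('N[leb]_2%:E[EFin \o u])%E.

Definition sq_integrable (u : R -> R) : Prop :=
  measurable_fun [set: R] u /\ (L2_norm u < +oo)%E.

(* Integral of u(x) e^{-i x xi} over [-n, n], split into real and imaginary
   parts. *)
Definition fourier_trunc (u : R -> R) (n : nat) (xi : R) : R[i] :=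
  Complex (\int[leb]_(x in `[- n%:R, n%:R]) (u x * cos (x * xi)))
          (- \int[leb]_(x in `[- n%:R, n%:R]) (u x * sin (x * xi))).

(* Fourier-Plancherel transform of a square-integrable function: the limit in
   L^2 of the truncated transforms; it determines g almost everywhere. *)
Definition is_fourier (u : R -> R) (g : R -> R[i]) : Prop :=
  [/\ measurable_fun [set: R] (fun xi => complex.Re (g xi)),
      measurable_fun [set: R] (fun xi => complex.Im (g xi)) &
      L2_norm (fun xi => normc (fourier_trunc u n xi - g xi))
        @[n --> \oo] --> 0%E].

Definition fourier (u : R -> R) : R -> R[i] :=
  xget (fun=> 0) [set g | is_fourier u g].

Definition Hs_norm (s : R) (u : R -> R) : \bar R :=
  L2_norm (fun xi => (1 + xi ^+ 2) `^ (s / 2) * normc (fourier u xi)).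

(* Membership of the function u in H^s(R), for s > 1/2. Continuity selects the
   continuous representative of the class. By Plancherel's theorem the third
   clause follows from the second one; it makes the value of [fourier u]
   explicit. *)
Definition in_Hs (s : R) (u : R -> R) : Prop :=
  [/\ continuous u, sq_integrable u, is_fourier u (fourier u) &
      (Hs_norm s u < +oo)%E].

(* u : [0, T] -> H^s is continuously differentiable with derivative ut, the
   limits being taken in the norm of H^s and one-sided at 0 and T.
   The time variable comes first. *)
Definition C1_Hs_with (s T : R) (u ut : R -> R -> R) : Prop :=
  [/\ forall t, t \in `[0, T] -> in_Hs s (u t),
      forall t, t \in `[0, T] -> in_Hs s (ut t),
      forall t, t \in `[0, T] ->
        Hs_norm s (fun x => (r - t)^-1 * (u r x - u t x) - ut t x)
          @[r --> within `[0, T] t^'] --> 0%E &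
      forall t, t \in `[0, T] ->
        Hs_norm s (fun x => ut r x - ut t x)
          @[r --> within `[0, T] (nbhs t)] --> 0%E].

End SobolevSpace.

Section Problem.
Context {R : realType}.
Local Notation leb := (@lebesgue_measure R).

Definition Ck (k : nat) (f : R -> R) : Prop :=
  (forall j, (j < k)%N -> forall x, derivable (derive1n j f) x 1)
  /\ continuous (derive1n k f).

Definition test_function (psi : R -> R) : Prop :=
  (forall k, Ck k psi) /\ exists M : R, forall x, M < `|x| -> psi x = 0.

(* beta' = mu in the sense of distributions. The integral against the signed
   measure mu is the difference of the integrals against its positive and
   negative parts. *)
Definition distr_derivative (beta : R -> R)
    (mu : {charge set (measurableTypeR R) -> \bar R}) : Prop :=
  forall P N (muPN : hahn_decomposition mu P N) (psi : R -> R),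
    test_function psi ->
    \int[leb]_x (beta x * derive1 psi x) =
    - (\int[jordan_pos muPN]_x psi x - \int[jordan_neg muPN]_x psi x).

Definition convolution (beta v : R -> R) (x : R) : R :=
  \int[leb]_y (beta (x - y) * v y).

(* u belongs to C^1([0, T], H^s) and u_t + (beta * f(u))_x = 0, u(0) = phi. *)
Definition ivp_solution (s T : R) (f beta phi : R -> R) (u : R -> R -> R) :
    Prop :=
  exists ut : R -> R -> R,
    [/\ C1_Hs_with s T u ut,
        forall t, t \in `]0, T] -> forall x,
          derivable (convolution beta (f \o u t)) x 1 /\
          ut t x + derive1 (convolution beta (f \o u t)) x = 0 &
        forall x, u 0 x = phi x].

Definition grid (h : R) (i : int) : R := i%:~R * h.

(* D beta (x_i - x_j), which depends only on k = i - j. *)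
Definition Dgrid (h : R) (beta : R -> R) (k : int) : R :=
  (beta (grid h (k + 1)) - beta (grid h (k - 1))) / (2 * h).

(* The indices -N, ..., N are encoded as k - N with k < 2N+1. *)
Definition idx (N : nat) (k : 'I_N.*2.+1) : int := (k : nat)%:Z - N%:Z.

Definition discrete_solution (T h : R) (N : nat) (f beta phi : R -> R)
    (v : 'I_N.*2.+1 -> R -> R) : Prop :=
  (forall i, v i 0 = phi (grid h (idx i))) /\
  (forall i t, t \in `[0, T] ->
     (r - t)^-1 * (v i r - v i t) @[r --> within `[0, T] t^'] -->
       - \sum_(j < N.*2.+1) h * Dgrid h beta (idx i - idx j) * f (v j t)).

End Problem.

(* Main.v *)
Require Import Defs.
From mathcomp Require Import all_boot all_order all_algebra.
From mathcomp Require Import all_classical all_reals all_analysis.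
From mathcomp.real_closed Require Import complex.
From mathcomp Require Import measurable_realfun.
From mathcomp Require Import ring lra zify.

Import Order.TTheory GRing.Theory Num.Theory.
Import numFieldNormedType.Exports.

Local Open Scope classical_set_scope.
Local Open Scope ring_scope.

(** Why the theorem holds.

    On the grid the exact solution satisfies the finite system up to a defect.
    Write V for the total variation of mu and g for f (u t). The derivative
    of beta * g at a grid point x_i is the integral of g (x_i - z) against mu.
    The sum over j of h D beta (x_i - x_j) g (x_j) is also an integral against
    mu, namely of a step function: h D beta (x_i - x_j) is half the mu-mass of
    an interval of length 2 h, and every z lies in exactly two of these
    intervals, those of the two grid points next to x_i - z. If g is
    L-Lipschitz and bounded by eta outside the window [-N h, N h], the two
    integrands differ by at most L h + eta, so the defect is at most
    V (L h + eta) ([convolution_derivative_grid]). For the same reason the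
    absolute row sums of the system are bounded by V, uniformly in h and N
    ([grid_weights_le]). Stability is then Gronwall's inequality for the
    maximum norm ([gronwall]), and the error is O(h + eta)
    ([grid_system_error]). The window is chosen large enough for u to be at
    most eps outside of it, and f 0 = 0 turns this into eta = O(eps).

    What has to be known of u is therefore: uniform bounds on its values and
    Lipschitz constants on [0, T], uniform decay at infinity, and
    differentiability in time at each fixed x. All of this follows from one
    Sobolev inequality ([sobolev_combination]), which bounds
    a1 u(x1) + a2 u(x2) by the H^s norm whenever the corresponding combination
    of exponentials grows at most linearly in the frequency; the weights
    (1, 0) give the sup bound and (1, -1) the Lipschitz bound. It is proved
    without Fourier inversion: u is smoothed by the Fejer kernel, whose
    transform has compact support, so that the smoothed values are integrals
    over a bounded set of frequencies of the truncated transforms that define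
    the Fourier-Plancherel transform. Then the truncation and the smoothing
    parameter are sent to infinity, in this order. A compactness argument on
    [0, T] makes the estimates uniform in time ([C1_Hs_uniform],
    [C1_Hs_vanishes]), a Lipschitz function in L^2 being one that vanishes at
    infinity ([lipschitz_L2_vanishes]).

    The nonlinearity is only locally Lipschitz. The finite system is first
    solved, by Picard iteration ([picard]), for f truncated outside
    [-(B + 1), B + 1], where B bounds |u|. When C (h + eps) <= 1 the error
    estimate confines the solution to that interval, so that the truncation is
    inactive; and any other solution of the original system coincides with it
    ([grid_system_unique]). *)

(** * Integration on the line and on rectangles *)

Section sobolev.
Context {R : realType}.
Local Notation leb := (@lebesgue_measure R).

Lemma lebesgue_measure_reflect (x : R) (A : set R) : measurable A ->
  pushforward leb ((fun y => x - y)%R : measurableTypeR R -> measurableTypeR R) A = leb A.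
Proof.
move=> mA; apply/esym/lebesgue_measure_unique => //=.
  exact: measurable_funB.
move=> mf _ [[a b]] _ <-.
rewrite /pushforward.
rewrite (_ : _ @^-1` _ = `[x - b, x - a[%classic); last first.
  by apply/seteqP; split => y /=; rewrite !in_itv/=; lra.
rewrite !lebesgue_measure_itv/= !lte_fin.
by rewrite ltrD2l ltrN2; case: ifP => // _; rewrite -!EFinD; congr EFin; ring.
Qed.

Lemma measurable_reflect (x : R) :
  measurable_fun (T:=measurableTypeR R) (U:=measurableTypeR R) [set: R] (fun y : R => x - y).
Proof. exact: measurable_funB. Qed.

Lemma integral_pushforward_reflect (x : R) (g : R -> \bar R) :
  (\int[pushforward leb ((fun y => x - y)%R : measurableTypeR R -> measurableTypeR R)]_y g y
   = \int[leb]_y g y)%E.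
Proof.
have h := measurable_reflect x.
apply: eq_measure_integral => A mA _.
exact: (lebesgue_measure_reflect x A mA).
Qed.

Lemma integrable_measurable (f : R -> R) :
  leb.-integrable [set: R] (EFin \o f) -> measurable_fun [set: R] f.
Proof. by move=> /(measurable_int leb) /measurable_EFinP. Qed.

Lemma integrable_reflect (x : R) (f : R -> R) :
  leb.-integrable [set: R] (EFin \o f) ->
  leb.-integrable [set: R] (EFin \o (fun y => f (x - y))).
Proof.
move=> /integrableP[mf fi].
have mphi := measurable_reflect x.
apply/integrableP; split; first exact: (measurableT_comp mf mphi).
move: fi; rewrite -(integral_pushforward_reflect x) ge0_integral_pushforward//.
exact: measurableT_comp.
Qed.

Lemma Rintegral_reflect (x : R) (f : R -> R) :
  leb.-integrable [set: R] (EFin \o f) ->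
  \int[leb]_y f (x - y) = \int[leb]_y f y.
Proof.
move=> fi; rewrite /Rintegral; congr fine.
rewrite -[RHS](integral_pushforward_reflect x) integral_pushforward//.
- exact: measurable_reflect.
- exact: (measurable_int leb).
- exact: integrable_reflect.
Qed.

(** Brings the truncations to [-n, n] in the definition of the transform back to
    integrals over the whole line. *)
Lemma cvg_Rintegral_growing (f : R -> R) :
  leb.-integrable [set: R] (EFin \o f) ->
  \int[leb]_(y in `[- n%:R, n%:R]) f y @[n --> \oo] --> \int[leb]_y f y.
Proof.
move=> fi; rewrite /Rintegral.
apply: fine_cvg; rewrite fineK; last exact: integrable_fin_num.
have mf := integrable_measurable f fi.
under eq_fun do rewrite integral_mkcond.
apply: (@dominated_cvg _ _ _ leb setT _ _ _ (fun x => `|(f x)%:E|)%E) => //.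
- move=> n; apply/(measurable_restrictT _ _).1 => //.
  apply/measurable_EFinP; exact: measurable_funS mf.
- move=> x _; apply: cvg_near_cst.
  near=> n; rewrite patchE mem_set//= in_itv/=.
  have : `|x| <= n%:R by near: n; exact: nbhs_infty_ger.
  by rewrite ler_norml.
- exact: integrable_abse.
- move=> n x _; rewrite patchE; case: ifP => // _.
  by rewrite abse0.
Unshelve. all: by end_near. Qed.

Lemma integrable_dominated (f g : R -> R) (A : set R) : measurable A -> measurable_fun A f ->
  leb.-integrable A (EFin \o g) -> (forall x, A x -> `|f x| <= g x) ->
  leb.-integrable A (EFin \o f).
Proof.
move=> mA mf + fg; apply: le_integrable => //; first exact/measurable_EFinP.
by move=> z Az /=; rewrite lee_fin; exact/(le_trans (fg z Az))/ler_norm.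
Qed.

Lemma integrable_scale d (T : measurableType d) (mu : {measure set T -> \bar R}) (D : set T) (c : R) (f : T -> R) :
  measurable D -> mu.-integrable D (EFin \o f) -> mu.-integrable D (EFin \o (fun x => c * f x)).
Proof. by move=> mD fi; exact: (integrableZl mD c fi). Qed.

Lemma integrable_add d (T : measurableType d) (mu : {measure set T -> \bar R}) (D : set T) (f g : T -> R) :
  measurable D -> mu.-integrable D (EFin \o f) -> mu.-integrable D (EFin \o g) ->
  mu.-integrable D (EFin \o (fun x => f x + g x)).
Proof. by move=> mD fi gi; exact: (integrableD mD fi gi). Qed.

Lemma integrable_sub d (T : measurableType d) (mu : {measure set T -> \bar R}) (D : set T) (f g : T -> R) :
  measurable D -> mu.-integrable D (EFin \o f) -> mu.-integrable D (EFin \o g) ->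
  mu.-integrable D (EFin \o (fun x => f x - g x)).
Proof. by move=> mD fi gi; exact: (integrableB mD fi gi). Qed.

Lemma integrable_norm_fun d (T : measurableType d) (mu : {measure set T -> \bar R}) (D : set T) (f : T -> R) :
  mu.-integrable D (EFin \o f) ->
  mu.-integrable D (EFin \o (fun x => `|f x|)).
Proof. by move=> fi; exact: (integrable_norm fi). Qed.

Lemma Rintegral_subset_le (f : R -> R) (A : set R) : measurable A ->
  leb.-integrable [set: R] (EFin \o f) -> (forall x, 0 <= f x) ->
  \int[leb]_(x in A) f x <= \int[leb]_x f x.
Proof.
move=> mA fi f0; have mf := integrable_measurable f fi.
rewrite fine_le//.
- by apply: integrable_fin_num => //; exact: (integrableS _ _ _ fi).
- exact: integrable_fin_num.
- apply: ge0_subset_integral => //; first exact/measurable_EFinP.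
  by move=> x _; rewrite lee_fin.
Qed.

Lemma Rintegral_Fubini d1 d2 (T1 : measurableType d1) (T2 : measurableType d2)
    (m1 : {sigma_finite_measure set T1 -> \bar R})
    (m2 : {sigma_finite_measure set T2 -> \bar R}) (F : T1 * T2 -> R) :
  (m1 \x m2)%E.-integrable [set: T1 * T2] (EFin \o F) ->
  (forall x, m2.-integrable [set: T2] (fun y => (F (x, y))%:E)) ->
  (forall y, m1.-integrable [set: T1] (fun x => (F (x, y))%:E)) ->
  \int[m1]_x \int[m2]_y F (x, y) = \int[m2]_y \int[m1]_x F (x, y).
Proof.
move=> iF i1 i2; rewrite /Rintegral; congr fine.
under eq_integral.
  move=> x _; rewrite fineK; last first.
  apply: integrable_fin_num => //.
  over.
rewrite (Fubini iF).
apply: eq_integral => y _; rewrite fineK//.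
exact: integrable_fin_num.
Qed.

Lemma Rintegrable_fubini d1 d2 (T1 : measurableType d1) (T2 : measurableType d2)
    (m1 : {sigma_finite_measure set T1 -> \bar R})
    (m2 : {sigma_finite_measure set T2 -> \bar R}) (F : T1 * T2 -> R) :
  (m1 \x m2)%E.-integrable [set: T1 * T2] (EFin \o F) ->
  (forall x, m2.-integrable [set: T2] (fun y => (F (x, y))%:E)) ->
  m1.-integrable [set: T1] (EFin \o (fun x => \int[m2]_y F (x, y))).
Proof.
move=> iF i1; have := integrable_fubini_F iF.
apply: eq_integrable => // x _.
rewrite /= fineK//; exact: integrable_fin_num.
Qed.

Lemma restrict_prod T1 T2 (A : set T1) (B : set T2) (F : T1 * T2 -> R) x y :
  (F \_ (A `*` B)) (x, y) = ((fun x => ((fun y => F (x, y)) \_ B) y) \_ A) x.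
Proof.
rewrite !patchE in_setX/=.
by case: (x \in A); case: (y \in B).
Qed.

Lemma integrable_rect d1 d2 (T1 : measurableType d1) (T2 : measurableType d2)
    (m1 : {sigma_finite_measure set T1 -> \bar R})
    (m2 : {sigma_finite_measure set T2 -> \bar R}) (F : T1 * T2 -> R) A B (M : R) :
  measurable A -> measurable B -> (m1 A < +oo)%E -> (m2 B < +oo)%E ->
  measurable_fun [set: T1 * T2] F ->
  (forall x y, A x -> B y -> `|F (x, y)| <= M) ->
  (m1 \x m2)%E.-integrable [set: T1 * T2] (EFin \o (F \_ (A `*` B))).
Proof.
move=> mA mB fA fB mF FM.
have mAB : measurable (A `*` B) by exact: measurableX.
rewrite -restrict_EFin; apply/(integrable_mkcond _ mAB).
apply: measurable_bounded_integrable => //.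
- rewrite [X in (X < _)%E](_ : _ = m1 A * m2 B)%E; last exact: product_measure1E.
  by rewrite lte_mul_pinfty// ?ge0_fin_numE//.
- exact: measurable_funS mF.
- exists M; split; first exact: num_real.
  move=> K MK -[x y] /= [Ax By]; apply: le_trans (ltW MK); exact: FM.
Qed.

(** The function is extended by zero outside the rectangle, where it is bounded,
    so that it becomes integrable for the product measure. The integrability of
    the inner integral comes with it, and with that the measurability of the
    truncated transforms. *)
Lemma Rintegral_rect_swap d1 d2 (T1 : measurableType d1) (T2 : measurableType d2)
    (m1 : {sigma_finite_measure set T1 -> \bar R})
    (m2 : {sigma_finite_measure set T2 -> \bar R}) (F : T1 * T2 -> R) A B (M : R) :
  measurable A -> measurable B -> (m1 A < +oo)%E -> (m2 B < +oo)%E ->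
  measurable_fun setT F ->
  (forall x y, A x -> B y -> `|F (x, y)| <= M) ->
  \int[m1]_(x in A) \int[m2]_(y in B) F (x, y) =
  \int[m2]_(y in B) \int[m1]_(x in A) F (x, y) /\
  m1.-integrable A (EFin \o (fun x => \int[m2]_(y in B) F (x, y))).
Proof.
move=> mA mB fA fB mF FM.
have iF := integrable_rect _ _ _ _ m1 m2 F A B M mA mB fA fB mF FM.
have Fx x : m2.-integrable setT (fun y => ((F \_ (A `*` B)) (x, y))%:E).
  have [Ax|nAx] := pselect (A x); last first.
    under eq_fun do rewrite restrict_prod patchE memNset//.
    exact: integrable0.
  under eq_fun do rewrite restrict_prod patchE mem_set//.
  rewrite -[X in integrable _ _ X]/(EFin \o ((fun y => F (x, y)) \_ B)) -restrict_EFin.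
  apply/(integrable_mkcond _ mB).
  apply: measurable_bounded_integrable => //.
    apply: measurable_funTS. apply: measurableT_comp => //.
  exists M; split; first exact: num_real.
  by move=> K MK y /= By; apply: le_trans (ltW MK); exact: FM.
have Fy y : m1.-integrable setT (fun x => ((F \_ (A `*` B)) (x, y))%:E).
  under eq_fun do rewrite restrict_prod.
  rewrite -[X in integrable _ _ X]/(EFin \o ((fun x => ((fun y => F (x, y)) \_ B) y) \_ A)) -restrict_EFin.
  apply/(integrable_mkcond _ mA).
  have [By|nBy] := pselect (B y); last first.
    under eq_fun do rewrite /= patchE memNset//.
    exact: integrable0.
  under eq_fun do rewrite /= patchE mem_set//.
  apply: measurable_bounded_integrable => //.
    apply: measurable_funTS. apply: measurableT_comp => //.
  exists M; split; first exact: num_real.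
  by move=> K MK x /= Ax; apply: le_trans (ltW MK); exact: FM.
have E x : \int[m2]_y (F \_ (A `*` B)) (x, y) = ((fun x => \int[m2]_(y in B) F (x, y)) \_ A) x.
  under eq_Rintegral do rewrite restrict_prod patchE.
  rewrite patchE; case: ifPn => _; last by rewrite Rintegral_cst// mul0r.
  by rewrite [RHS]Rintegral_mkcond.
split; last first.
  have := Rintegrable_fubini _ _ _ _ _ _ _ iF Fx.
  under [X in _ \o X]eq_fun do rewrite E.
  by rewrite -restrict_EFin => /(integrable_mkcond _ mA).
have := Rintegral_Fubini _ _ _ _ _ _ _ iF Fx Fy.
under eq_Rintegral do rewrite E.
rewrite -Rintegral_mkcond => ->.
rewrite [RHS]Rintegral_mkcond.
apply: eq_Rintegral => y _.
rewrite [RHS]patchE [in RHS]Rintegral_mkcond.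
have [By|nBy] := pselect (B y).
  rewrite mem_set//.
  by apply: eq_Rintegral => x _; rewrite restrict_prod !patchE (mem_set By).
rewrite memNset//.
under eq_Rintegral do rewrite restrict_prod !patchE (memNset nBy) if_same.
by rewrite Rintegral_cst// mul0r.
Qed.
(** * The Fejer kernel *)

Lemma integrable_oneDsqrV : leb.-integrable [set: R] (EFin \o (fun x : R => (1 + x ^+ 2)^-1)).
Proof.
have mf : measurable_fun [set: R] (fun x : R => (1 + x ^+ 2)^-1).
  exact: continuous_measurable_fun (@continuous_oneDsqrV R).
apply/integrableP; split; first exact/measurable_EFinP.
under eq_integral.
  move=> x _. rewrite /= ger0_norm; last by rewrite invr_ge0 addr_ge0// sqr_ge0.
  over.
rewrite ge0_symfun_integralT.
- rewrite -set_itvcy integral0y_oneDsqr -EFinM; exact: ltry.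
- by move=> x; rewrite invr_ge0 addr_ge0// sqr_ge0.
- exact: continuous_oneDsqrV.
- by move=> x /=; rewrite sqrrN.
Qed.

(** Closed form of the cosine transform of the triangle function 1 - xi / m on
    [0, m], as [fejerE] shows; m / 2 is the limit at z = 0. The closed form gives
    positivity and decay, the integral form gives compactly supported
    frequencies. *)
Definition fejer (m z : R) : R :=
  if z == 0 then m / 2 else (1 - cos (m * z)) / (m * z ^+ 2).

Lemma derivable_continuous_at (f : R -> R) (x : R) : derivable f x 1 -> {for x, continuous f}.
Proof. by move=> df; apply: differentiable_continuous; apply/derivable1_diffP. Qed.

Lemma is_derive_FTC2 (a b : R) (f F : R -> R) : a < b ->
  (forall x : R, is_derive x 1 F (f x)) -> continuous f ->
  \int[leb]_(x in `[a, b]) f x = F b - F a.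
Proof.
move=> ab dF cf; rewrite /Rintegral (continuous_FTC2 ab (F := F))//.
- exact: continuous_subspaceT.
- have cF x : {for x, continuous F}.
    by apply: derivable_continuous_at; exact: ex_derive.
  split.
  + by move=> x _; exact: ex_derive.
  + by apply: cvg_at_right_filter; exact: cF.
  + by apply: cvg_at_left_filter; exact: cF.
- by move=> x _; rewrite derive1E; apply: derive_val.
Qed.

Lemma fejerE (m z : R) : 0 < m ->
  \int[leb]_(xi in `[0, m]) ((1 - xi / m) * cos (z * xi)) = fejer m z.
Proof.
move=> m0; have mn0 : m != 0 by rewrite gt_eqF.
have cf : continuous (fun xi : R => (1 - xi / m) * cos (z * xi)).
  by move=> x; apply: derivable_continuous_at; exact: ex_derive.
rewrite /fejer; case: eqVneq => [z0|z0].
  have dF (x : R) : is_derive x 1 (fun x => x - x ^+ 2 / (2 * m)) ((1 - x / m) * cos (z * x)).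
    apply: is_derive_eq; rewrite z0 mul0r cos0 /GRing.scale/=.
    by field.
  rewrite (is_derive_FTC2 _ _ _ _ m0 dF cf).
  by field.
have dF (x : R) : is_derive x 1 (fun x => (1 - x / m) * sin (z * x) / z - cos (z * x) / (m * z ^+ 2))
    ((1 - x / m) * cos (z * x)).
  apply: is_derive_eq; rewrite /GRing.scale/=; field.
  by rewrite z0 mn0.
rewrite (is_derive_FTC2 _ _ _ _ m0 dF cf).
rewrite divff// subrr mulr0 sin0 cos0 [z * m]mulrC; field.
by rewrite z0 mn0.
Qed.

Lemma fejer_ge0 (m z : R) : 0 < m -> 0 <= fejer m z.
Proof.
move=> m0; rewrite /fejer; case: ifPn => _; first by rewrite divr_ge0// ltW.
by rewrite divr_ge0 ?subr_ge0 ?cos_le1// mulr_ge0 ?sqr_ge0// ltW.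
Qed.

Lemma fejer_far (m z : R) : 0 < m -> z != 0 -> fejer m z <= 2 / (m * z ^+ 2).
Proof.
move=> m0 z0; rewrite /fejer (negbTE z0) ler_pM2r; last first.
  by rewrite invr_gt0 mulr_gt0// exprn_even_gt0.
have := cos_geN1 (m * z); lra.
Qed.

Lemma fejer_integrand_integrable (m z : R) :
  leb.-integrable `[0, m] (EFin \o (fun xi => (1 - xi / m) * cos (z * xi))).
Proof.
apply: continuous_compact_integrable; first exact: segment_compact.
apply: continuous_subspaceT => x.
by apply: derivable_continuous_at; exact: ex_derive.
Qed.

Lemma fejer_le (m z : R) : 0 < m -> fejer m z <= m.
Proof.
move=> m0; rewrite -fejerE//.
apply: (@le_trans _ _ (\int[leb]_(xi in `[0, m]) 1)); last first.
  by rewrite Rintegral_cst//= lebesgue_measure_itv/= lte_fin m0 mul1r sube0.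
apply: le_Rintegral => //.
- exact: fejer_integrand_integrable.
- apply: continuous_compact_integrable; first exact: segment_compact.
  by apply: continuous_subspaceT => x; exact: cvg_cst.
- move=> xi /=; rewrite in_itv/= => /andP[xi0 xim].
  have h0 : 0 <= 1 - xi / m by rewrite subr_ge0 ler_pdivrMr// mul1r.
  have h1 : 1 - xi / m <= 1 by rewrite gerBl divr_ge0// ltW.
  have h2 := cos_le1 (z * xi).
  nra.
Qed.

(** For |z| <= 1 / m the phases z xi stay in [-1, 1], where the cosine is at
    least cos 1. *)
Lemma fejer_near (m z : R) : 0 < m -> `|z| <= m^-1 -> cos 1 * m / 2 <= fejer m z.
Proof.
move=> m0 zm; rewrite -fejerE//.
have -> : cos 1 * m / 2 = \int[leb]_(xi in `[0, m]) ((1 - xi / m) * cos (0 * xi) * cos 1).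
  rewrite RintegralZr ?fejerE ?/fejer ?eqxx//; last exact: fejer_integrand_integrable.
  by rewrite -mulrA mulrC.
apply: le_Rintegral => //.
- have := fejer_integrand_integrable m 0.
  by move/(integrableZr _ (cos 1)); apply.
- exact: fejer_integrand_integrable.
- move=> xi /=; rewrite in_itv/= => /andP[xi0 xim].
  rewrite mul0r cos0 mulr1; apply: ler_wpM2l.
    by rewrite subr_ge0 ler_pdivrMr// mul1r.
  have zx1 : `|z * xi| <= 1.
    rewrite normrM (ger0_norm xi0).
    apply: (@le_trans _ _ (m^-1 * m)); last by rewrite mulVf// gt_eqF.
    exact: ler_pM.
  rewrite -[cos (z * xi)]cos_norm.
  have pi2 := @pi_ge2 R.
  rewrite leNgt ltr_cos ?in_itv/= -?leNgt//.
  + by rewrite ler01/=; lra.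
  + by rewrite normr_ge0/=; lra.
Qed.

Lemma measurable_inv : measurable_fun [set: R] (fun x : R => x^-1).
Proof.
rewrite -(setUv [set 0]); apply/measurable_funU => //.
  exact: measurableC.
split; first exact: measurable_fun_set1.
apply: open_continuous_measurable_fun; first exact/closed_openC/closed_eq.
move=> x /set_mem/= /eqP x0; exact: inv_continuous.
Qed.

Lemma measurable_fejer (m : R) : measurable_fun [set: R] (fejer m).
Proof.
rewrite /fejer; apply: measurable_fun_ifT => //.
- apply: measurable_fun_eqr => //.
- apply: measurable_funM.
    apply: measurable_funB => //.
    apply: (measurableT_comp (continuous_measurable_fun (@continuous_cos R))).
    exact: measurable_funM.
  apply: (measurableT_comp measurable_inv).
  apply: measurable_funM => //; exact: measurable_funX.
Qed.

(** An integrable majorant: [fejer_le] serves near the origin, [fejer_far] away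
    from it. *)
Lemma fejer_decay (m : R) : 0 < m -> forall z, fejer m z <= (2 * m + 4 / m) * (1 + z ^+ 2)^-1.
Proof.
move=> m0 z; have z2 := sqr_ge0 z.
rewrite ler_pdivlMr; last lra.
have m1 : 0 < m^-1 by rewrite invr_gt0.
have [z1|z1] := lerP (z ^+ 2) 1.
  have := fejer_le m z m0. have := fejer_ge0 m z m0; nra.
have z0 : z != 0 by apply: contraTneq z1 => ->; rewrite expr0n/= ltr10.
have := fejer_far m z m0 z0; have := fejer_ge0 m z m0.
rewrite ler_pdivlMr; last by rewrite mulr_gt0//; lra.
move=> h1 h2.
have h3 : fejer m z * z ^+ 2 <= 2 / m.
  by rewrite ler_pdivlMr//; lra.
nra.
Qed.

Lemma integrable_fejer (m : R) : 0 < m -> leb.-integrable [set: R] (EFin \o fejer m).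
Proof.
move=> m0; have ig := integrableZl measurableT (2 * m + 4 / m) integrable_oneDsqrV.
apply: (integrable_dominated _ _ _ measurableT (measurable_fejer m) ig) => z _.
by rewrite ger0_norm ?fejer_ge0//; exact: fejer_decay.
Qed.

(** The peak |z| <= 1 / m alone contributes cos 1, for every m; this is what
    [sobolev_combination] divides by. *)
Lemma fejer_mass (m : R) : 0 < m -> cos 1 <= \int[leb]_z fejer m z.
Proof.
move=> m0.
have -> : cos 1 = \int[leb]_(z in `[- m^-1, m^-1]) (cos 1 * m / 2).
  rewrite Rintegral_cst//= lebesgue_measure_itv/= lte_fin.
  rewrite ifT/=; first by field; rewrite gt_eqF.
  have : 0 < m^-1 by rewrite invr_gt0.
  lra.
apply: (@le_trans _ _ (\int[leb]_(z in `[- m^-1, m^-1]) fejer m z)).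
  apply: le_Rintegral => //.
  - apply: continuous_compact_integrable; first exact: segment_compact.
    by apply: continuous_subspaceT => x; exact: cvg_cst.
  - exact: (integrableS _ _ _ (integrable_fejer m m0)).
  - move=> z /=; rewrite in_itv/= -ler_norml; exact: fejer_near.
rewrite fine_le//; last apply: ge0_subset_integral => //.
- apply: integrable_fin_num => //; exact: (integrableS _ _ _ (integrable_fejer m m0)).
- apply: integrable_fin_num => //; exact: integrable_fejer.
- by have mf := measurable_fejer m; exact/measurable_EFinP.
- by move=> z _; rewrite lee_fin fejer_ge0.
Qed.

Lemma oneDsqrV_ge0 (z : R) : 0 <= (1 + z ^+ 2)^-1.
Proof. by rewrite invr_ge0 addr_ge0// sqr_ge0. Qed.

Lemma oneDsqrV_le1 (z : R) : (1 + z ^+ 2)^-1 <= 1.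
Proof. by rewrite invf_le1 ?lerDl ?sqr_ge0// ltr_pwDl// sqr_ge0. Qed.

(** With q = 1 / (1 + (x - y)^2) <= 1, the product |u| q is at most u^2 + q, by the
    arithmetic-geometric mean inequality. *)
Lemma integrable_mul_fejer (u : R -> R) (m x : R) : 0 < m ->
  measurable_fun [set: R] u -> leb.-integrable [set: R] (EFin \o (fun y => u y ^+ 2)) ->
  leb.-integrable [set: R] (EFin \o (fun y => u y * fejer m (x - y))).
Proof.
move=> m0 mu iu.
have c0 : 0 <= 2 * m + 4 / m by have := @invr_gt0 R m; rewrite m0 => h; lra.
have ig : leb.-integrable [set: R] (EFin \o (fun y => (2 * m + 4 / m) * (u y ^+ 2 + (1 + (x - y) ^+ 2)^-1))).
  have i2 := integrableD measurableT iu (integrable_reflect x _ integrable_oneDsqrV).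
  exact: (integrableZl measurableT (2 * m + 4 / m) i2).
apply: (integrable_dominated _ _ _ measurableT _ ig).
  apply: measurable_funM => //.
  have mf := measurable_fejer m.
  apply: (measurableT_comp mf). exact: measurable_funB.
move=> y _; rewrite normrM (ger0_norm (fejer_ge0 m (x - y) m0)).
apply: (@le_trans _ _ (`|u y| * ((2 * m + 4 / m) * (1 + (x - y) ^+ 2)^-1))).
  by apply: ler_wpM2l => //; exact: fejer_decay.
rewrite mulrCA; apply: ler_wpM2l => //.
have := oneDsqrV_ge0 (x - y); have := oneDsqrV_le1 (x - y).
rewrite -(real_normK (num_real (u y))); move: (normr_ge0 (u y)).
set a := `|u y|; set b := (_^-1) => a0 b1 b0.
have := sqr_ge0 (a - b); nra.
Qed.

(** Smoothing reproduces u x times the mass of the kernel. Near x this is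
    continuity. Away from x the kernel is at most a multiple of
    1 / (m (1 + (x - y)^2)), whose product with u is integrable, so this part is
    O(1 / m) with a constant D that does not depend on m. *)
Lemma fejer_approx (u : R -> R) (x om : R) : {for x, continuous u} ->
  measurable_fun [set: R] u -> leb.-integrable [set: R] (EFin \o (fun y => u y ^+ 2)) ->
  0 < om -> exists2 D : R, 0 <= D & forall m : R, 0 < m ->
  `|\int[leb]_y (u y * fejer m (x - y)) - u x * \int[leb]_z fejer m z|
    <= om * \int[leb]_z fejer m z + D / m.
Proof.
move=> cu mu iu om0.
have [eta /= eta0 ueta] : \forall y \near x, `|u x - u y| < om.
  by move/cvgrPdist_lt : cu; apply.
pose D0 := 2 * (1 + eta ^- 2).
have iq := integrable_reflect x _ integrable_oneDsqrV.
have ih : leb.-integrable [set: R] (EFin \o (fun y => u y ^+ 2 + (1 + `|u x|) * (1 + (x - y) ^+ 2)^-1)).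
  exact: (integrableD measurableT iu (integrableZl measurableT (1 + `|u x|) iq)).
pose I := \int[leb]_y (u y ^+ 2 + (1 + `|u x|) * (1 + (x - y) ^+ 2)^-1).
have I0 : 0 <= I.
  apply: Rintegral_ge0 => y _. rewrite addr_ge0 ?sqr_ge0// mulr_ge0 ?oneDsqrV_ge0//.
have D00 : 0 <= D0 by rewrite mulr_ge0// addr_ge0// invr_ge0 sqr_ge0.
exists (D0 * I); first exact: mulr_ge0.
move=> m m0.
have iK := integrable_fejer m m0.
have iKx := integrable_reflect x _ iK.
have iuK := integrable_mul_fejer u m x m0 mu iu.
have iuxK := integrableZl measurableT (u x) iKx.
have iomK := integrableZl measurableT om iKx.
have iDh := integrableZl measurableT (D0 / m) ih.
have -> : D0 * I / m = \int[leb]_y (D0 / m * (u y ^+ 2 + (1 + `|u x|) * (1 + (x - y) ^+ 2)^-1)).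
  by rewrite RintegralZl// mulrAC.
rewrite -(Rintegral_reflect x _ iK) -!RintegralZl// -RintegralB//.
apply: le_trans (le_normr_Rintegral _ _) _ => //.
  exact: (integrableB measurableT iuK iuxK).
rewrite -RintegralD//.
apply: le_Rintegral => //.
- exact: (integrable_norm (integrableB measurableT iuK iuxK)).
- exact: (integrableD measurableT iomK iDh).
move=> y _.
rewrite -mulrBl normrM [`|fejer _ _|]ger0_norm ?fejer_ge0//.
have K0 := fejer_ge0 m (x - y) m0.
have h0 : 0 <= D0 / m * (u y ^+ 2 + (1 + `|u x|) * (1 + (x - y) ^+ 2)^-1).
  rewrite mulr_ge0 ?divr_ge0 ?(ltW m0)//.
  rewrite addr_ge0 ?sqr_ge0// mulr_ge0 ?oneDsqrV_ge0//.
have [near|far] := ltrP `|x - y| eta.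
  apply: ler_wpDr => //; apply: ler_wpM2r => //.
  by rewrite distrC ltW//; exact: ueta.
apply: ler_wpDl; first by rewrite mulr_ge0// ltW.
have z0 : x - y != 0 by rewrite -normr_gt0; exact: lt_le_trans far.
have Kle : fejer m (x - y) <= D0 / m * (1 + (x - y) ^+ 2)^-1.
  apply: le_trans (fejer_far m _ m0 z0) _.
  have e2 : 0 < eta ^+ 2 by rewrite exprn_gt0.
  have z2 : eta ^+ 2 <= (x - y) ^+ 2.
    by rewrite -(real_normK (num_real (x - y))) ler_sqr ?nnegrE// ltW.
  have w0 : 0 < (x - y) ^+ 2 by exact: lt_le_trans z2.
  have h : ((x - y) ^+ 2)^-1 <= (1 + eta ^- 2) * (1 + (x - y) ^+ 2)^-1.
    rewrite ler_pdivlMr; last by rewrite addr_gt0.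
    by rewrite mulrDr mulr1 mulVf ?gt_eqF// addrC lerD2l lef_pV2.
  rewrite invfM mulrA /D0.
  rewrite [leRHS](_ : _ = 2 / m * ((1 + eta ^- 2) * (1 + (x - y) ^+ 2)^-1)); last by ring.
  by rewrite ler_pM2l// divr_gt0.
apply: le_trans (ler_wpM2l (normr_ge0 _) Kle) _.
rewrite mulrCA; apply: ler_wpM2l; first by rewrite divr_ge0// ltW.
have := oneDsqrV_ge0 (x - y); have := oneDsqrV_le1 (x - y).
set q := (_ ^-1) => q1 q0.
apply: le_trans (ler_wpM2r q0 (ler_normB (u y) (u x))) _.
rewrite -(real_normK (num_real (u y))).
move: (normr_ge0 (u y)) (normr_ge0 (u x)).
set a := `|u y|; set b := `|u x| => a0 b0.
have := sqr_ge0 (a - q); nra.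
Qed.

(** * Truncated Fourier transforms *)

Lemma within_continuous_bounded (e : R -> R) (a b : R) : {within `[a, b], continuous e} ->
  exists M : R, forall t, t \in `[a, b] -> `|e t| <= M.
Proof.
move=> ce; have := @compact_bounded _ _ _ (continuous_compact ce (@segment_compact R a b)).
move=> [M [_ /(_ (M + 1))]]; rewrite ltrDl ltr01 => /(_ isT) h.
by exists (M + 1) => t tab; apply: h; exists t.
Qed.

Lemma continuous_integrable_segment (f : R -> R) (a b : R) : continuous f ->
  leb.-integrable `[a, b] (EFin \o f).
Proof.
move=> cf; apply: continuous_compact_integrable; first exact: segment_compact.
exact: continuous_subspaceT.
Qed.

(** Stated for a general kernel k because it is used with cos and sin, where it
    yields the measurability of the truncated transform, and with the kernel
    (1 - xi / m) cos ((x - y) xi), where it yields [fejer_spectral]. *)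
Lemma trunc_swap (u : R -> R) (n : nat) (c d : R)
    (k : measurableTypeR R * measurableTypeR R -> R) : continuous u ->
  measurable_fun [set: measurableTypeR R * measurableTypeR R] k ->
  (forall xi y, c <= xi <= d -> `|k (xi, y)| <= 1) ->
  \int[leb]_(xi in `[c, d]) \int[leb]_(y in `[- n%:R, n%:R]) (u y * k (xi, y)) =
  \int[leb]_(y in `[- n%:R, n%:R]) \int[leb]_(xi in `[c, d]) (u y * k (xi, y)) /\
  leb.-integrable `[c, d] (EFin \o (fun xi => \int[leb]_(y in `[- n%:R, n%:R]) (u y * k (xi, y)))).
Proof.
move=> cu mk k1.
have [M uM] := within_continuous_bounded u (- n%:R) n%:R (continuous_subspaceT cu).
pose F (p : measurableTypeR R * measurableTypeR R) := u p.2 * k p.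
have mF : measurable_fun setT F.
  apply: measurable_funM => //.
  apply: measurableT_comp => //.
  exact: continuous_measurable_fun.
apply: (@Rintegral_rect_swap _ _ _ _ leb leb F _ _ M) => //.
- by rewrite /= lebesgue_measure_itv/=; case: ifP => _; rewrite ?ltry.
- by rewrite /= lebesgue_measure_itv/=; case: ifP => _; rewrite ?ltry.
- move=> xi y; rewrite /= in_itv/= => xim yn; rewrite /F/= normrM.
  rewrite -[M]mulr1; apply: ler_pM => //.
    exact: uM.
  exact: k1.
Qed.

Lemma measurable_cos_mul : measurable_fun [set: measurableTypeR R * measurableTypeR R] (fun p => cos (p.2 * p.1)).
Proof.
apply: (measurableT_comp (continuous_measurable_fun (@continuous_cos R))).
exact: measurable_funM.
Qed.

Lemma measurable_sin_mul : measurable_fun [set: measurableTypeR R * measurableTypeR R] (fun p => sin (p.2 * p.1)).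
Proof.
apply: (measurableT_comp (continuous_measurable_fun (@continuous_sin R))).
exact: measurable_funM.
Qed.

Lemma measurable_cover (f : R -> R) :
  (forall k : nat, measurable_fun (`[- k%:R, k%:R]%classic : set R) f) ->
  measurable_fun [set: R] f.
Proof.
move=> mf; have -> : [set: R] = \bigcup_k (`[- k%:R, k%:R]%classic : set R).
  apply/seteqP; split => // x _.
  exists (Num.truncn `|x|).+1 => //=; rewrite in_itv/= -ler_norml ltW//.
  exact: truncnS_gt.
by apply/measurable_fun_bigcup => // k; exact: measurable_itv.
Qed.

Lemma measurable_Re_trunc (u : R -> R) (n : nat) : continuous u ->
  measurable_fun [set: R] (fun xi => complex.Re (fourier_trunc u n xi)).
Proof.
move=> cu; apply: measurable_cover => k.
have [|_ /(measurable_int leb)/measurable_EFinP] // :=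
  trunc_swap u n (- k%:R) k%:R (fun p => cos (p.2 * p.1)) cu measurable_cos_mul.
by move=> xi y _; exact: cos_max.
Qed.

Lemma measurable_Im_trunc (u : R -> R) (n : nat) : continuous u ->
  measurable_fun [set: R] (fun xi => complex.Im (fourier_trunc u n xi)).
Proof.
move=> cu; apply: measurable_cover => k.
have [|_ /(measurable_int leb)/measurable_EFinP h] :=
  trunc_swap u n (- k%:R) k%:R (fun p => sin (p.2 * p.1)) cu measurable_sin_mul.
  by move=> xi y _; exact: sin_max.
have := measurable_funN h; exact.
Qed.

Lemma integrable_cos_trunc (u : R -> R) (n : nat) (m : R) : continuous u ->
  leb.-integrable `[0, m] (EFin \o (fun xi => complex.Re (fourier_trunc u n xi))).
Proof.
move=> cu.
have [] // := trunc_swap u n 0 m (fun p => cos (p.2 * p.1)) cu measurable_cos_mul.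
by move=> xi y _; exact: cos_max.
Qed.

Lemma integrable_sin_trunc (u : R -> R) (n : nat) (m : R) : continuous u ->
  leb.-integrable `[0, m] (EFin \o (fun xi => complex.Im (fourier_trunc u n xi))).
Proof.
move=> cu.
have [|_] := trunc_swap u n 0 m (fun p => sin (p.2 * p.1)) cu measurable_sin_mul.
  by move=> xi y _; exact: sin_max.
by move=> /integrableN; apply.
Qed.

Lemma integrable_mul_cos (u : R -> R) (a b xi : R) : continuous u ->
  leb.-integrable `[a, b] (EFin \o (fun y => u y * cos (y * xi))).
Proof.
move=> cu; apply: continuous_integrable_segment => y.
apply: continuousM; first exact: cu.
by apply: derivable_continuous_at; exact: ex_derive.
Qed.

Lemma integrable_mul_sin (u : R -> R) (a b xi : R) : continuous u ->
  leb.-integrable `[a, b] (EFin \o (fun y => u y * sin (y * xi))).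
Proof.
move=> cu; apply: continuous_integrable_segment => y.
apply: continuousM; first exact: cu.
by apply: derivable_continuous_at; exact: ex_derive.
Qed.

Lemma trunc_cosB (u : R -> R) (n : nat) (c x xi : R) : continuous u ->
  \int[leb]_(y in `[- n%:R, n%:R]) (u y * (c * cos ((x - y) * xi))) =
  c * (cos (x * xi) * complex.Re (fourier_trunc u n xi)
       - sin (x * xi) * complex.Im (fourier_trunc u n xi)).
Proof.
move=> cu; rewrite /fourier_trunc/=.
have ic := integrable_mul_cos u (- n%:R) n%:R xi cu.
have isn := integrable_mul_sin u (- n%:R) n%:R xi cu.
rewrite mulrN opprK -(RintegralZl (cos (x * xi)) _ ic)// -(RintegralZl (sin (x * xi)) _ isn)//.
have mI : measurable (`[- n%:R, n%:R]%classic : set (measurableTypeR R)).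
  exact: measurable_itv.
have ic' := integrable_scale _ _ _ _ (cos (x * xi)) _ mI ic.
have isn' := integrable_scale _ _ _ _ (sin (x * xi)) _ mI isn.
rewrite -(RintegralD _ ic' isn')//.
have ics := integrable_add _ _ _ _ _ _ mI ic' isn'.
rewrite -(RintegralZl c _ ics)//.
apply: eq_Rintegral => y _.
rewrite mulrBl cosB.
ring.
Qed.

(** The kernel is replaced by its cosine integral and the two integrals are
    exchanged. Only frequencies in [0, m] appear: this is what makes the
    convergence of the truncated transforms in L^2 sufficient for pointwise
    bounds on u. *)
Lemma fejer_spectral (u : R -> R) (n : nat) (m x : R) : continuous u -> 0 < m ->
  \int[leb]_(y in `[- n%:R, n%:R]) (u y * fejer m (x - y)) =
  \int[leb]_(xi in `[0, m]) ((1 - xi / m) *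
    (cos (x * xi) * complex.Re (fourier_trunc u n xi) - sin (x * xi) * complex.Im (fourier_trunc u n xi))).
Proof.
move=> cu m0.
pose k (p : measurableTypeR R * measurableTypeR R) := (1 - p.1 / m) * cos ((x - p.2) * p.1).
have [||E _] := trunc_swap u n 0 m k cu.
- apply: measurable_funM.
    apply: measurable_funB => //.
    exact: measurable_funM.
  apply: (measurableT_comp (continuous_measurable_fun (@continuous_cos R))).
  apply: measurable_funM => //.
  exact: measurable_funB.
- move=> xi y /andP[xi0 xim]; rewrite /k/= normrM mulr_ile1//.
  + have h : 0 <= xi / m <= 1 by rewrite divr_ge0 ?(ltW m0)//= ler_pdivrMr// mul1r.
    rewrite ler_norml; lra.
  + exact: cos_max.
transitivity (\int[leb]_(y in `[- n%:R, n%:R]) \int[leb]_(xi in `[0, m]) (u y * k (xi, y))).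
  apply: eq_Rintegral => y _.
  by rewrite -(fejerE m (x - y) m0) -(RintegralZl (u y) _ (fejer_integrand_integrable m (x - y))).
rewrite -E; apply: eq_Rintegral => xi _.
by rewrite -(trunc_cosB u n (1 - xi / m) x xi cu) /k.
Qed.

(** * The L^2 norm *)

Lemma L2_norm_sqr (w : R -> R) : (L2_norm w `^ 2 = \int[leb]_x (w x ^+ 2)%:E)%E.
Proof.
rewrite /L2_norm poweR_Lnorm//; apply: eq_integral => x _.
rewrite [LHS]/(`|w x|%R%:E `^ 2)%E powR_mulrn//.
by rewrite real_normK// num_real.
Qed.

Lemma L2_norm_ge0 (w : R -> R) : (0 <= L2_norm w)%E.
Proof. exact: Lnorm_ge0. Qed.

Lemma L2_norm_leP (w : R -> R) (b : R) : 0 <= b ->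
  (L2_norm w <= b%:E)%E <-> (\int[leb]_x (w x ^+ 2)%:E <= (b ^+ 2)%:E)%E.
Proof.
move=> b0; rewrite -L2_norm_sqr; have := L2_norm_ge0 w.
case: (L2_norm w) => [r| |] //=.
- by rewrite lee_fin => r0; rewrite powR_mulrn// !lee_fin ler_sqr ?nnegrE.
- by rewrite pnatr_eq0.
Qed.

Lemma L2_norm_lty (w : R -> R) :
  (L2_norm w < +oo)%E <-> (\int[leb]_x (w x ^+ 2)%:E < +oo)%E.
Proof.
rewrite -L2_norm_sqr; have := L2_norm_ge0 w.
case: (L2_norm w) => [r| |] //=.
- by rewrite !ltry.
- by rewrite pnatr_eq0.
Qed.

Lemma sq_integrable_integrable (w : R -> R) : sq_integrable w ->
  leb.-integrable [set: R] (EFin \o (fun x => w x ^+ 2)).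
Proof.
move=> [mw /L2_norm_lty wfin]; apply/integrableP; split.
  apply/measurable_EFinP; exact: measurable_funX.
move: wfin; congr (_ < _)%E; apply: eq_integral => x _.
by rewrite /= ger0_norm// sqr_ge0.
Qed.

Lemma ereal_cvg0 T (F : set_system T) (FF : Filter F) (f : T -> \bar R) :
  (forall x, (0 <= f x)%E) -> (forall e : R, 0 < e -> \forall x \near F, (f x <= e%:E)%E) ->
  f x @[x --> F] --> 0%E.
Proof.
move=> f0 fe; apply/fine_cvgP; split.
  apply: filterS (fe 1 ltr01) => x fx1.
  by rewrite ge0_fin_numE//; exact: le_lt_trans fx1 (ltry _).
apply/cvgrPdist_le => e e0; apply: filterS (fe e e0) => x fxe.
rewrite /= sub0r normrN ger0_norm ?fine_ge0// -lee_fin fineK//.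
by rewrite ge0_fin_numE//; exact: le_lt_trans fxe (ltry _).
Qed.

Lemma ereal_cvg0_lt T (F : set_system T) (FF : Filter F) (f : T -> \bar R) (e : R) : 0 < e ->
  f x @[x --> F] --> 0%E -> \forall x \near F, (f x < e%:E)%E.
Proof.
move=> e0 fc; apply: (fc (fun x => (x < e%:E)%E)).
apply: open_nbhs_nbhs; split; first exact: open_ereal_lt_ereal.
by rewrite /= lte_fin.
Qed.

Lemma L2_norm_cvg0 (w : nat -> R -> R) (e : R) : 0 < e ->
  L2_norm (w n) @[n --> \oo] --> 0%E ->
  \forall n \near \oo, (\int[leb]_x (w n x ^+ 2)%:E <= (e ^+ 2)%:E)%E.
Proof.
move=> e0 /(ereal_cvg0_lt _ _ _ _ _ e0); apply: filterS => n h.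
by apply/L2_norm_leP; exact: ltW.
Qed.

Lemma measurable_normc (g : R -> R[i]) :
  measurable_fun [set: R] (fun xi => complex.Re (g xi)) ->
  measurable_fun [set: R] (fun xi => complex.Im (g xi)) ->
  measurable_fun [set: R] (fun xi => ComplexField.Normc.normc (g xi)).
Proof.
move=> mr mi.
rewrite (_ : (fun xi => _) = (fun xi => Num.sqrt (complex.Re (g xi) ^+ 2 + complex.Im (g xi) ^+ 2))).
  apply: (measurableT_comp (continuous_measurable_fun (@sqrt_continuous R))).
  by apply: measurable_funD; exact: measurable_funX.
by apply/funext => xi; case: (g xi).
Qed.

Lemma Re_le_normc (z : R[i]) : `|complex.Re z| <= ComplexField.Normc.normc z.
Proof.
case: z => a b /=; rewrite -sqrtr_sqr; apply: ler_wsqrtr.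
by rewrite lerDl sqr_ge0.
Qed.

Lemma Im_le_normc (z : R[i]) : `|complex.Im z| <= ComplexField.Normc.normc z.
Proof.
case: z => a b /=; rewrite -sqrtr_sqr; apply: ler_wsqrtr.
by rewrite lerDr sqr_ge0.
Qed.

Lemma integrable_sqr_le (w : R -> R) (c : R) : measurable_fun [set: R] w ->
  (\int[leb]_x (w x ^+ 2)%:E <= c%:E)%E ->
  leb.-integrable [set: R] (EFin \o (fun x => w x ^+ 2)) /\ \int[leb]_x (w x ^+ 2) <= c.
Proof.
move=> mw wc; split.
  by apply: sq_integrable_integrable; split => //; apply/L2_norm_lty/(le_lt_trans wc)/ltry.
rewrite -lee_fin /Rintegral fineK// ge0_fin_numE; first exact/(le_lt_trans wc)/ltry.
by apply: integral_ge0 => x _; rewrite lee_fin sqr_ge0.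
Qed.

Lemma measurable_trunc_err (u : R -> R) (g : R -> R[i]) (n : nat) : continuous u ->
  measurable_fun [set: R] (fun xi => complex.Re (g xi)) ->
  measurable_fun [set: R] (fun xi => complex.Im (g xi)) ->
  measurable_fun [set: R] (fun xi => ComplexField.Normc.normc (fourier_trunc u n xi - g xi)).
Proof.
move=> cu mr mi; apply: measurable_normc.
- rewrite (_ : (fun xi => _) = (fun xi => complex.Re (fourier_trunc u n xi) - complex.Re (g xi))).
    by apply: measurable_funB => //; exact: measurable_Re_trunc.
  by apply/funext => xi; case: fourier_trunc => ? ?; case: (g xi).
- rewrite (_ : (fun xi => _) = (fun xi => complex.Im (fourier_trunc u n xi) - complex.Im (g xi))).
    by apply: measurable_funB => //; exact: measurable_Im_trunc.
  by apply/funext => xi; case: fourier_trunc => ? ?; case: (g xi).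
Qed.

(** * Sobolev inequalities by Fejer smoothing *)

(** Divided by the weight, the growth 1 + |xi| allowed in [sobolev_combination]
    leaves at most a multiple of 1 / (1 + |xi|), which is square integrable. This
    is where s >= 2 enters. *)
Lemma weight_ge (s : R) (xi : R) : 2 <= s -> 1 + xi ^+ 2 <= (1 + xi ^+ 2) `^ (s / 2).
Proof.
move=> s2; have h : 1 <= 1 + xi ^+ 2 by rewrite lerDl sqr_ge0.
rewrite -{1}[1 + xi ^+ 2]powRr1; last by lra.
by apply: ler_powR => //; lra.
Qed.

Lemma measurable_weight (s : R) : measurable_fun [set: R] (fun xi : R => (1 + xi ^+ 2) `^ (s / 2)).
Proof.
apply: (measurableT_comp (measurable_powR _)).
apply: measurable_funD => //; exact: measurable_funX.
Qed.

(** The role of each variable: a is the truncated transform at xi, p its L^2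
    limit, G a bound on the modulus of p, P the weighted modulus, E the
    truncation error. The products (1 + xi) G and (1 + xi) E are split by the
    arithmetic-geometric mean inequality, with the parameter b (a bound on the
    H^s norm) for the first and kap (a bound on the L^2 norm of E) for the
    second, so that after integration both terms become linear in b and kap. *)
Lemma spectral_term_le (s b kap m xi G P E a p : R) : 2 <= s -> 0 < b -> 0 < kap -> 0 <= xi <= m ->
  0 <= G -> P = (1 + xi ^+ 2) `^ (s / 2) * G -> `|p| <= G -> `|a - p| <= E ->
  (1 + xi) * `|a| <= b * (1 + xi ^+ 2)^-1 + (2 * b)^-1 * P ^+ 2
      + (1 + m) / 2 * (kap + kap^-1 * E ^+ 2).
Proof.
move=> s2 b0 k0 /andP[xi0 xim] G0 -> pG apE.
have E0 : 0 <= E by exact: le_trans apE.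
have aGE : `|a| <= G + E.
  by rewrite -(subrK p a); apply: le_trans (ler_normD _ _) _; rewrite addrC lerD.
have EE : E <= 2^-1 * (kap + kap^-1 * E ^+ 2).
  rewrite -subr_ge0.
  have -> : 2^-1 * (kap + kap^-1 * E ^+ 2) - E = (2 * kap)^-1 * (kap - E) ^+ 2.
    by field; rewrite gt_eqF.
  by rewrite mulr_ge0 ?sqr_ge0// invr_ge0 mulr_ge0// ltW.
have GG : (1 + xi) * G <= b * (1 + xi ^+ 2)^-1 + (2 * b)^-1 * ((1 + xi ^+ 2) `^ (s / 2) * G) ^+ 2.
  have w := weight_ge s xi s2.
  set W := _ `^ _ in w *.
  have q0 : 0 < 1 + xi ^+ 2 by rewrite ltr_pwDl// sqr_ge0.
  have WG : (1 + xi ^+ 2) * G <= W * G by rewrite ler_wpM2r.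
  apply: (@le_trans _ _ (b * (1 + xi ^+ 2)^-1 + (2 * b)^-1 * ((1 + xi ^+ 2) * G) ^+ 2)); last first.
    rewrite lerD2l ler_wpM2l ?invr_ge0 ?mulr_ge0 ?(ltW b0)//.
    have h1 : 0 <= (1 + xi ^+ 2) * G by rewrite mulr_ge0// ltW.
    by rewrite ler_sqr ?nnegrE// (le_trans h1).
  rewrite -subr_ge0.
  (* Sum of squares: the excess over the square of (1 + xi) b is accounted
     for by 2 (1 + xi^2) - (1 + xi)^2 = (1 - xi)^2. *)
  have -> : b / (1 + xi ^+ 2) + (2 * b)^-1 * ((1 + xi ^+ 2) * G) ^+ 2 - (1 + xi) * G
     = (2 * b * (1 + xi ^+ 2) ^+ 2)^-1 * ((1 + xi) * b - (1 + xi ^+ 2) ^+ 2 * G) ^+ 2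
       + b * (2 * (1 + xi ^+ 2) ^+ 2)^-1 * (1 - xi) ^+ 2.
    by field; rewrite !gt_eqF.
  have q2 : 0 < (1 + xi ^+ 2) ^+ 2 by rewrite exprn_gt0.
  have b2 : 0 <= 2 * b by rewrite mulr_ge0// ltW.
  apply: addr_ge0; apply: mulr_ge0; rewrite ?sqr_ge0//.
    by rewrite invr_ge0 mulr_ge0// ltW.
  by rewrite divr_ge0 ?(ltW b0)// mulr_ge0// ltW.
apply: (@le_trans _ _ ((1 + xi) * G + (1 + m) * E)).
  apply: le_trans (ler_wpM2l _ aGE) _; first by rewrite addr_ge0.
  by rewrite mulrDr lerD2l ler_wpM2r// lerD2l.
apply: lerD => //.
rewrite -mulrA ler_wpM2l// addr_ge0//; exact: le_trans xim.
Qed.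

(** The part of the bound that contains kap depends on m, but kap tends to 0 as
    n grows while m is fixed. *)
Lemma spectral_bound (u : R -> R) (g : R -> R[i]) (s b kap m a1 a2 x1 x2 Q : R) (n : nat) :
  continuous u -> 2 <= s -> 0 < b -> 0 < kap -> 0 < m -> 0 <= Q ->
  measurable_fun [set: R] (fun xi => complex.Re (g xi)) ->
  measurable_fun [set: R] (fun xi => complex.Im (g xi)) ->
  (L2_norm (fun xi => ((1 + xi ^+ 2) `^ (s / 2) * ComplexField.Normc.normc (g xi))%R) <= b%:E)%E ->
  (\int[leb]_xi (ComplexField.Normc.normc (fourier_trunc u n xi - g xi)%R ^+ 2)%:E <= (kap ^+ 2)%:E)%E ->
  (forall xi, `|a1 * cos (x1 * xi) + a2 * cos (x2 * xi)| <= Q * (1 + `|xi|)) ->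
  (forall xi, `|a1 * sin (x1 * xi) + a2 * sin (x2 * xi)| <= Q * (1 + `|xi|)) ->
  `|a1 * \int[leb]_(y in `[- n%:R, n%:R]) (u y * fejer m (x1 - y))
    + a2 * \int[leb]_(y in `[- n%:R, n%:R]) (u y * fejer m (x2 - y))|
  <= Q * (b * (2 * \int[leb]_xi (1 + xi ^+ 2)^-1 + 1) + (1 + m) ^+ 2 * kap).
Proof.
move=> cu s2 b0 k0 m0 Q0 mr mi gb Ek hc hs.
rewrite !fejer_spectral//.
pose A xi := complex.Re (fourier_trunc u n xi).
pose B xi := complex.Im (fourier_trunc u n xi).
pose G xi := ComplexField.Normc.normc (g xi).
pose P xi := (1 + xi ^+ 2) `^ (s / 2) * G xi.
pose E xi := ComplexField.Normc.normc (fourier_trunc u n xi - g xi).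
have mA : measurable_fun [set: R] A by exact: measurable_Re_trunc.
have mB : measurable_fun [set: R] B by exact: measurable_Im_trunc.
have mG : measurable_fun [set: R] G by exact: measurable_normc.
have mP : measurable_fun [set: R] P by apply: measurable_funM => //; exact: measurable_weight.
have mE : measurable_fun [set: R] E by exact: measurable_trunc_err.
have [iP Pb] : leb.-integrable [set: R] (EFin \o (fun x => P x ^+ 2)) /\ \int[leb]_x (P x ^+ 2) <= b ^+ 2.
  by apply: integrable_sqr_le => //; apply/L2_norm_leP => //; exact: ltW.
have [iE Eb] := integrable_sqr_le E _ mE Ek.
pose T x xi := (1 - xi / m) * (cos (x * xi) * A xi - sin (x * xi) * B xi).
pose W xi := b * (1 + xi ^+ 2)^-1 + (2 * b)^-1 * P xi ^+ 2 + (1 + m) / 2 * (kap + kap^-1 * E xi ^+ 2).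
have mI : measurable (`[0, m]%classic : set (measurableTypeR R)) by exact: measurable_itv.
have iA : leb.-integrable `[0, m] (EFin \o A) by exact: integrable_cos_trunc.
have iB : leb.-integrable `[0, m] (EFin \o B) by exact: integrable_sin_trunc.
have mtr (h : R -> R) (x : R) : continuous h -> measurable_fun [set: R] (fun xi => h (x * xi)).
  move=> ch; apply: (measurableT_comp (continuous_measurable_fun ch)).
  exact: measurable_funM.
have h01 xi : 0 <= xi <= m -> 0 <= 1 - xi / m <= 1.
  move=> /andP[xi0 xim]; rewrite subr_ge0 ler_pdivrMr// mul1r xim/= gerBl divr_ge0//.
  exact: ltW.
have iT x : leb.-integrable `[0, m] (EFin \o T x).
  have iAB := integrable_add _ _ _ _ _ _ mI (integrable_norm_fun _ _ _ _ _ iA) (integrable_norm_fun _ _ _ _ _ iB).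
  apply: (integrable_dominated _ _ _ mI _ iAB).
    apply: measurable_funTS; apply: measurable_funM.
      apply: measurable_funB => //; exact: measurable_funM.
    by apply: measurable_funB; apply: measurable_funM => //; apply: mtr;
      [exact: continuous_cos|exact: continuous_sin].
  move=> xi; rewrite /= in_itv/= => /h01/andP[h0 h1].
  rewrite /T normrM (ger0_norm h0).
  apply: le_trans (_ : _ <= 1 * `|cos (x * xi) * A xi - sin (x * xi) * B xi|) _.
    by rewrite ler_wpM2r.
  rewrite mul1r; apply: le_trans (ler_normB _ _) _.
  rewrite !normrM; apply: lerD; rewrite -[leRHS]mul1r ler_wpM2r//.
    exact: cos_max.
  exact: sin_max.
have i1 := integrable_scale _ _ _ _ a1 _ mI (iT x1).
have i2 := integrable_scale _ _ _ _ a2 _ mI (iT x2).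
rewrite -(RintegralZl a1 mI (iT x1)) -(RintegralZl a2 mI (iT x2)) -(RintegralD mI i1 i2).
have i12 := integrable_add _ _ _ _ _ _ mI i1 i2.
apply: le_trans (le_normr_Rintegral mI i12) _.
have iq := integrable_scale _ _ _ _ b _ measurableT integrable_oneDsqrV.
have iP2 := integrable_scale _ _ _ _ (2 * b)^-1 _ measurableT iP.
have iE2 := integrable_scale _ _ _ _ kap^-1 _ measurableT iE.
have onI f : leb.-integrable [set: R] (EFin \o f) -> leb.-integrable `[0, m] (EFin \o f).
  by move=> fi; exact: (integrableS _ _ _ fi).
have ik : leb.-integrable `[0, m] (EFin \o (fun=> kap)).
  by apply: continuous_integrable_segment => ?; exact: cvg_cst.
have iqP := integrable_add _ _ _ _ _ _ mI (onI _ iq) (onI _ iP2).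
have ikE := integrable_add _ _ _ _ _ _ mI ik (onI _ iE2).
have ikE2 := integrable_scale _ _ _ _ ((1 + m) / 2) _ mI ikE.
have iW : leb.-integrable `[0, m] (EFin \o W) := integrable_add _ _ _ _ _ _ mI iqP ikE2.
apply: (@le_trans _ _ (\int[leb]_(xi in `[0, m]) (2 * Q * W xi))).
  apply: le_Rintegral => //.
  - exact: (integrable_norm_fun _ _ _ _ _ i12).
  - exact: (integrable_scale _ _ _ _ _ _ mI iW).
  - move=> xi; rewrite /= in_itv/= => xim; have /andP[h0 h1] := h01 _ xim.
    have := hc xi; have := hs xi.
    have xi0 : 0 <= xi by case/andP: xim.
    rewrite (ger0_norm xi0) => hsi hci.
    have G0 : 0 <= G xi by exact: le_trans (normr_ge0 _) (Re_le_normc _).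
    have WA : (1 + xi) * `|A xi| <= W xi.
      apply: (@spectral_term_le s b kap m xi (G xi) (P xi) (E xi) (A xi) (complex.Re (g xi))) => //.
        exact: Re_le_normc.
      apply: le_trans (Re_le_normc _).
      by rewrite /A; case: fourier_trunc => ? ?; case: (g xi).
    have WB : (1 + xi) * `|B xi| <= W xi.
      apply: (@spectral_term_le s b kap m xi (G xi) (P xi) (E xi) (B xi) (complex.Im (g xi))) => //.
        exact: Im_le_normc.
      apply: le_trans (Im_le_normc _).
      by rewrite /B; case: fourier_trunc => ? ?; case: (g xi).
    rewrite /T.
    rewrite (_ : _ + _ = (1 - xi / m) * ((a1 * cos (x1 * xi) + a2 * cos (x2 * xi)) * A xi
       - (a1 * sin (x1 * xi) + a2 * sin (x2 * xi)) * B xi)); last by ring.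
    rewrite normrM (ger0_norm h0).
    apply: le_trans (_ : _ <= 1 * `|(a1 * cos (x1 * xi) + a2 * cos (x2 * xi)) * A xi
       - (a1 * sin (x1 * xi) + a2 * sin (x2 * xi)) * B xi|) _.
      by rewrite ler_wpM2r.
    rewrite mul1r; apply: le_trans (ler_normB _ _) _; rewrite !normrM.
    have -> : 2 * Q * W xi = Q * W xi + Q * W xi by ring.
    apply: lerD.
      apply: le_trans (ler_wpM2r _ hci) _ => //.
      by rewrite -mulrA ler_wpM2l.
    apply: le_trans (ler_wpM2r _ hsi) _ => //.
    by rewrite -mulrA ler_wpM2l.
rewrite (RintegralZl (2 * Q) mI iW) (RintegralD mI iqP ikE2) (RintegralD mI (onI _ iq) (onI _ iP2)).
rewrite (RintegralZl _ mI ikE) (RintegralD mI ik (onI _ iE2)).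
rewrite (RintegralZl b mI (onI _ integrable_oneDsqrV)) (RintegralZl _ mI (onI _ iP)) (RintegralZl _ mI (onI _ iE)).
have := Rintegral_subset_le _ _ mI integrable_oneDsqrV oneDsqrV_ge0.
have := Rintegral_subset_le _ _ mI iP (fun x => sqr_ge0 (P x)).
have := Rintegral_subset_le _ _ mI iE (fun x => sqr_ge0 (E x)).
have -> : \int[leb]_(xi in `[0, m]) kap = kap * m.
  by rewrite Rintegral_cst//= lebesgue_measure_itv/= lte_fin m0 sube0.
move=> /le_trans/(_ Eb) => Eb' /le_trans/(_ Pb) Pb' J'.
have {}Pb' : (2 * b)^-1 * \int[leb]_(x in `[0, m]) (P x ^+ 2) <= b / 2.
  apply: (@le_trans _ _ ((2 * b)^-1 * b ^+ 2)).
    by rewrite ler_wpM2l// invr_ge0 mulr_ge0// ltW.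
  by rewrite le_eqVlt; apply/orP; left; apply/eqP; field; rewrite gt_eqF.
have {}Eb' : kap^-1 * \int[leb]_(x in `[0, m]) (E x ^+ 2) <= kap.
  apply: (@le_trans _ _ (kap^-1 * kap ^+ 2)).
    by rewrite ler_wpM2l// invr_ge0 ltW.
  by rewrite expr2 mulKf// gt_eqF.
have {}J' : b * \int[leb]_(x in `[0, m]) (1 + x ^+ 2)^-1 <= b * \int[leb]_x (1 + x ^+ 2)^-1.
  by rewrite ler_wpM2l// ltW.
have m1 : 0 <= (1 + m) / 2 by rewrite divr_ge0// addr_ge0// ltW.
have {}Eb' : (1 + m) / 2 * (kap * m + kap^-1 * \int[leb]_(x in `[0, m]) (E x ^+ 2)) <= (1 + m) / 2 * (kap * m + kap).
  by rewrite ler_wpM2l// lerD2l.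
rewrite -mulrA mulrCA ler_wpM2l//.
rewrite [leRHS](_ : _ = 2 * (b * \int[leb]_x (1 + x ^+ 2)^-1 + b / 2 + (1 + m) / 2 * (kap * m + kap))); last by field.
by rewrite ler_pM2l// lerD// lerD.
Qed.

Lemma smoothed_combination_le (u : R -> R) (g : R -> R[i]) (s b m a1 a2 x1 x2 Q : R) :
  continuous u -> sq_integrable u -> is_fourier u g ->
  2 <= s -> 0 < b -> 0 < m -> 0 <= Q ->
  (L2_norm (fun xi => ((1 + xi ^+ 2) `^ (s / 2) * ComplexField.Normc.normc (g xi))%R) <= b%:E)%E ->
  (forall xi, `|a1 * cos (x1 * xi) + a2 * cos (x2 * xi)| <= Q * (1 + `|xi|)) ->
  (forall xi, `|a1 * sin (x1 * xi) + a2 * sin (x2 * xi)| <= Q * (1 + `|xi|)) ->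
  `|a1 * \int[leb]_y (u y * fejer m (x1 - y)) + a2 * \int[leb]_y (u y * fejer m (x2 - y))|
  <= Q * (b * (2 * \int[leb]_xi (1 + xi ^+ 2)^-1 + 1)).
Proof.
move=> cu su [mr mi fu] s2 b0 m0 Q0 gb hc hs.
apply/ler_addgt0Pr => e e0.
(* This makes the part of the bound that depends on m at most e. *)
pose kap : R := e / ((Q + 1) * (1 + m) ^+ 2).
have m1 : 0 < (1 + m) ^+ 2 by rewrite exprn_gt0// addr_gt0.
have Q1 : 0 < Q + 1 by rewrite ltr_wpDl.
have k0 : 0 < kap by rewrite divr_gt0// mulr_gt0.
have nE := L2_norm_cvg0 _ _ k0 fu.
have iu := sq_integrable_integrable u su.
have mu : measurable_fun [set: R] u by exact: continuous_measurable_fun.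
have cI x := cvg_Rintegral_growing _ (integrable_mul_fejer u m x m0 mu iu).
have cS : a1 * \int[leb]_(y in `[- n%:R, n%:R]) (u y * fejer m (x1 - y))
    + a2 * \int[leb]_(y in `[- n%:R, n%:R]) (u y * fejer m (x2 - y)) @[n --> \oo] -->
    a1 * \int[leb]_y (u y * fejer m (x1 - y)) + a2 * \int[leb]_y (u y * fejer m (x2 - y)).
  by apply: cvgD; apply: cvgMr; exact: cI.
apply: (cvgr_to_le (cvg_norm cS)).
apply: filterS nE => n En.
apply: le_trans (spectral_bound u g s b kap m a1 a2 x1 x2 Q n cu s2 b0 k0 m0 Q0 mr mi gb En hc hs) _.
rewrite mulrDr lerD2l /kap.
rewrite (_ : _ * _ = Q / (Q + 1) * e); last by field; rewrite !gt_eqF// addr_gt0.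
rewrite ler_piMl ?(ltW e0)// ler_pdivrMr// mul1r lerDl//.
Qed.

(** Sending m to infinity: the smoothed values converge to the values of u times
    the mass of the kernel, which is at least cos 1. *)
Lemma sobolev_combination (u : R -> R) (g : R -> R[i]) (s b a1 a2 x1 x2 Q : R) :
  continuous u -> sq_integrable u -> is_fourier u g ->
  2 <= s -> 0 < b -> 0 <= Q ->
  (L2_norm (fun xi => ((1 + xi ^+ 2) `^ (s / 2) * ComplexField.Normc.normc (g xi))%R) <= b%:E)%E ->
  (forall xi, `|a1 * cos (x1 * xi) + a2 * cos (x2 * xi)| <= Q * (1 + `|xi|)) ->
  (forall xi, `|a1 * sin (x1 * xi) + a2 * sin (x2 * xi)| <= Q * (1 + `|xi|)) ->
  `|a1 * u x1 + a2 * u x2| <= Q * (b * (2 * \int[leb]_xi (1 + xi ^+ 2)^-1 + 1)) / cos 1.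
Proof.
move=> cu su fu s2 b0 Q0 gb hc hs.
have iu := sq_integrable_integrable u su.
have mu : measurable_fun [set: R] u by exact: continuous_measurable_fun.
set V := Q * _.
have c0 := cos1_gt0 R.
apply/ler_addgt0Pr => e e0.
pose aa : R := `|a1| + `|a2| + 1.
have aa0 : 0 < aa by rewrite ltr_pwDr// addr_ge0.
pose om : R := e / aa.
have om0 : 0 < om by rewrite divr_gt0.
have [D1 D10 h1] := fejer_approx u x1 om (cu x1) mu iu om0.
have [D2 D20 h2] := fejer_approx u x2 om (cu x2) mu iu om0.
pose D : R := `|a1| * D1 + `|a2| * D2.
have D0 : 0 <= D by rewrite addr_ge0// mulr_ge0.
(* With this m the error D / m is at most om times the mass of the kernel. *)
pose m : R := (D + 1) / (cos 1 * om).
have D1p : 0 < D + 1 by exact: ltr_wpDl.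
have com : 0 < cos 1 * om by exact: mulr_gt0.
have m0 : 0 < m by exact: divr_gt0.
have {}h1 := h1 m m0; have {}h2 := h2 m m0.
have hV := smoothed_combination_le u g s b m a1 a2 x1 x2 Q cu su fu s2 b0 m0 Q0 gb hc hs.
rewrite -/V in hV.
have kc := fejer_mass m m0.
move: h1 h2 hV kc.
set K := \int[leb]_z fejer m z.
set I1 := \int[leb]_y _; set I2 := \int[leb]_y _ => h1 h2 hV kc.
have K0 : 0 < K by exact: lt_le_trans kc.
have Dm : D / m <= cos 1 * om.
  by rewrite ler_pdivrMr// [leRHS]mulrC /m divfK ?gt_eqF// lerDl.
have key : K * `|a1 * u x1 + a2 * u x2| <= V + (`|a1| + `|a2|) * (om * K) + D / m.
  rewrite -{1}(gtr0_norm K0) -normrM.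
  rewrite (_ : K * _ = (a1 * I1 + a2 * I2) - a1 * (I1 - u x1 * K) - a2 * (I2 - u x2 * K)); last by ring.
  apply: le_trans (ler_normB _ _) _; apply: le_trans (lerD (ler_normB _ _) (lexx _)) _.
  rewrite !normrM.
  have := ler_wpM2l (normr_ge0 a1) h1; have := ler_wpM2l (normr_ge0 a2) h2.
  have -> : D / m = `|a1| * (D1 / m) + `|a2| * (D2 / m) by rewrite /D; ring.
  rewrite !mulrDr => k2 k1. lra.
have V0 : 0 <= V by exact: le_trans hV.
rewrite -(ler_pM2l K0); apply: le_trans key _.
rewrite mulrDr -addrA; apply: lerD.
  by rewrite mulrCA ler_peMr// ler_pdivlMr// mul1r.
have -> : e = om * aa by rewrite /om divfK// gt_eqF.
rewrite /aa. have : cos 1 * om <= K * om by rewrite ler_wpM2r// ltW.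
nra.
Qed.

(** * Comparison of derivatives *)

(** The mean value theorem for psi + e and psi - e, whose derivatives are
    nonnegative. *)
Lemma comparison (e psi de dpsi : R -> R) (a b : R) : a <= b ->
  {within `[a, b], continuous e} -> {within `[a, b], continuous psi} ->
  (forall t, t \in `]a, b[ -> is_derive t 1 e (de t)) ->
  (forall t, t \in `]a, b[ -> is_derive t 1 psi (dpsi t)) ->
  (forall t, t \in `]a, b[ -> `|de t| <= dpsi t) ->
  `|e b - e a| <= psi b - psi a.
Proof.
rewrite le_eqVlt => /predU1P[->|ab] ce cp dE dP h; first by rewrite !subrr normr0.
have cD : {within `[a, b], continuous (psi \+ e)} by move=> x; apply: continuousD; [exact: cp|exact: ce].
have cB : {within `[a, b], continuous (psi \- e)} by move=> x; apply: continuousB; [exact: cp|exact: ce].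
have dD t : t \in `]a, b[ -> is_derive t 1 (psi \+ e) (dpsi t + de t).
  by move=> tab; have := dE t tab; have := dP t tab; move=> ? ?; exact: is_deriveD.
have dB t : t \in `]a, b[ -> is_derive t 1 (psi \- e) (dpsi t - de t).
  by move=> tab; have := dE t tab; have := dP t tab; move=> ? ?; exact: is_deriveB.
have [c1 c1ab /= E1] := MVT ab dD cD.
have [c2 c2ab /= E2] := MVT ab dB cB.
have := h c1 c1ab; have := h c2 c2ab.
rewrite !ler_norml => /andP[h1 h2] /andP[h3 h4].
have ba : 0 <= b - a by rewrite subr_ge0 ltW.
have k1 : 0 <= (dpsi c1 + de c1) * (b - a) by rewrite mulr_ge0//; lra.
have k2 : 0 <= (dpsi c2 - de c2) * (b - a) by rewrite mulr_ge0//; lra.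
lra.
Qed.

Lemma lipschitz_of_derive (f df : R -> R) (L : R) : (forall x : R, is_derive x 1 f (df x)) ->
  (forall x, `|df x| <= L) -> forall x y, `|f x - f y| <= L * `|x - y|.
Proof.
move=> dF Lf.
have h x y : y <= x -> `|f x - f y| <= L * `|x - y|.
  move=> yx; rewrite (ger0_norm (_ : 0 <= x - y)) ?subr_ge0// mulrBr.
  apply: (@comparison f (fun t => L * t) df (fun=> L)) => //.
  - apply: continuous_subspaceT => t; apply: derivable_continuous_at; exact: ex_derive.
  - apply: continuous_subspaceT => t; apply: derivable_continuous_at; exact: ex_derive.
  - move=> t _; apply: is_derive_eq. rewrite /GRing.scale/=; ring.
move=> x y; have [yx|xy] := orP (le_total y x); first exact: h.
by rewrite distrC [`|x - y|]distrC; exact: h.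
Qed.

Lemma cos_lipschitz (x y : R) : `|cos x - cos y| <= `|x - y|.
Proof.
rewrite -[leRHS]mul1r; apply: (lipschitz_of_derive cos (fun x => - sin x)) => z.
by rewrite normrN; exact: sin_max.
Qed.

Lemma sin_lipschitz (x y : R) : `|sin x - sin y| <= `|x - y|.
Proof.
rewrite -[leRHS]mul1r; apply: (lipschitz_of_derive sin cos) => z.
exact: cos_max.
Qed.

(** * Sup and Lipschitz bounds in H^s *)

Definition sobolev_const : R := (2 * \int[leb]_xi (1 + xi ^+ 2)^-1 + 1) / cos 1.

Lemma sobolev_const_gt0 : 0 < sobolev_const.
Proof.
rewrite divr_gt0 ?cos1_gt0// ltr_wpDl// mulr_ge0//; apply: Rintegral_ge0 => x _.
exact: oneDsqrV_ge0.
Qed.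

Lemma sobolev_sup (s b : R) (u : R -> R) : 2 <= s -> 0 < b ->
  continuous u -> sq_integrable u -> is_fourier u (fourier u) -> (Hs_norm s u <= b%:E)%E ->
  forall x, `|u x| <= sobolev_const * b.
Proof.
move=> s2 b0 cu su fu hb x.
have := sobolev_combination u _ s b 1 0 x 0 1 cu su fu s2 b0 ler01 hb.
rewrite mul1r mul0r addr0 => h.
apply: (le_trans (h _ _)).
- move=> xi; rewrite !mul1r mul0r addr0; apply: le_trans (cos_max _) _; by rewrite lerDl.
- move=> xi; rewrite !mul1r mul0r addr0; apply: le_trans (sin_max _) _; by rewrite lerDl.
- by rewrite [leLHS](_ : _ = sobolev_const * b)// /sobolev_const; ring.
Qed.

Lemma sobolev_lipschitz (s b : R) (u : R -> R) : 2 <= s -> 0 < b ->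
  continuous u -> sq_integrable u -> is_fourier u (fourier u) -> (Hs_norm s u <= b%:E)%E ->
  forall x y, `|u x - u y| <= sobolev_const * b * `|x - y|.
Proof.
move=> s2 b0 cu su fu hb x y.
have := sobolev_combination u _ s b 1 (- 1) x y `|x - y| cu su fu s2 b0 (normr_ge0 _) hb.
rewrite mul1r mulN1r => h.
apply: (le_trans (h _ _)).
- move=> xi; rewrite !mul1r mulN1r; apply: le_trans (cos_lipschitz _ _) _.
  by rewrite -mulrBl normrM ler_wpM2l// lerDr.
- move=> xi; rewrite !mul1r mulN1r; apply: le_trans (sin_lipschitz _ _) _.
  by rewrite -mulrBl normrM ler_wpM2l// lerDr.
- by rewrite [leLHS](_ : _ = sobolev_const * b * `|x - y|)// /sobolev_const; ring.
Qed.

(** * Linearity of the Fourier-Plancherel transform *)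

Lemma sq_integral_lin (w1 w2 w : R -> R) (a b e : R) :
  measurable_fun [set: R] w1 -> measurable_fun [set: R] w2 -> measurable_fun [set: R] w ->
  (forall x, w x ^+ 2 <= 2 * a ^+ 2 * w1 x ^+ 2 + 2 * b ^+ 2 * w2 x ^+ 2) ->
  (\int[leb]_x (w1 x ^+ 2)%:E <= (e ^+ 2)%:E)%E ->
  (\int[leb]_x (w2 x ^+ 2)%:E <= (e ^+ 2)%:E)%E ->
  (\int[leb]_x (w x ^+ 2)%:E <= (((2 * (`|a| + `|b|)) * e) ^+ 2)%:E)%E.
Proof.
move=> m1 m2 mw wle h1 h2.
have m1' : measurable_fun [set: R] (fun x => w1 x ^+ 2) by exact: measurable_funX.
have m2' : measurable_fun [set: R] (fun x => w2 x ^+ 2) by exact: measurable_funX.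
have mw' : measurable_fun [set: R] (fun x => w x ^+ 2) by exact: measurable_funX.
have [i1 I1] := integrable_sqr_le _ _ m1 h1.
have [i2 I2] := integrable_sqr_le _ _ m2 h2.
have j1 := integrable_scale _ _ _ _ (2 * a ^+ 2) _ measurableT i1.
have j2 := integrable_scale _ _ _ _ (2 * b ^+ 2) _ measurableT i2.
have j := integrable_add _ _ _ _ _ _ measurableT j1 j2.
have iw : leb.-integrable [set: R] (EFin \o (fun x => w x ^+ 2)).
  apply: (integrable_dominated _ _ _ measurableT mw' j) => x _.
  by rewrite ger0_norm ?sqr_ge0.
rewrite -(fineK (integrable_fin_num measurableT iw)) lee_fin.
apply: (@le_trans _ _ (\int[leb]_x (2 * a ^+ 2 * w1 x ^+ 2 + 2 * b ^+ 2 * w2 x ^+ 2))).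
  by apply: le_Rintegral.
rewrite (RintegralD measurableT j1 j2) (RintegralZl _ measurableT i1) (RintegralZl _ measurableT i2).
rewrite -(real_normK (num_real a)) -(real_normK (num_real b)).
apply: (@le_trans _ _ (2 * `|a| ^+ 2 * e ^+ 2 + 2 * `|b| ^+ 2 * e ^+ 2)).
  by apply: lerD; apply: ler_wpM2l => //; rewrite mulr_ge0// sqr_ge0.
have := normr_ge0 a; have := normr_ge0 b; have := sqr_ge0 e.
rewrite !exprMn; set x := e ^+ 2; set A := `|a|; set B := `|b| => x0 B0 A0.
rewrite -mulrDl ler_wpM2r//. nra.
Qed.

Lemma sq_integrable_lin (u v : R -> R) (a b : R) : sq_integrable u -> sq_integrable v ->
  sq_integrable (fun x => a * u x + b * v x).
Proof.
move=> su sv; have [mu _] := su; have [mv _] := sv.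
have mw : measurable_fun [set: R] (fun x => a * u x + b * v x).
  by apply: measurable_funD; exact: measurable_funM.
split => //; apply/L2_norm_lty.
have iu := sq_integrable_integrable u su; have iv := sq_integrable_integrable v sv.
have j1 := integrable_scale _ _ _ _ (2 * a ^+ 2) _ measurableT iu.
have j2 := integrable_scale _ _ _ _ (2 * b ^+ 2) _ measurableT iv.
have j := integrable_add _ _ _ _ _ _ measurableT j1 j2.
have iw : leb.-integrable [set: R] (EFin \o (fun x => (a * u x + b * v x) ^+ 2)).
  apply: (integrable_dominated _ _ _ measurableT _ j) => [|x _]; first exact: measurable_funX.
  rewrite ger0_norm ?sqr_ge0//.
  by have := sqr_ge0 (a * u x - b * v x); lra.
exact: integrable_lty.
Qed.

Lemma continuous_lin (u v : R -> R) (a b : R) : continuous u -> continuous v ->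
  continuous (fun x => a * u x + b * v x).
Proof. by move=> cu cv x; apply: cvgD; apply: cvgMr; [exact: cu|exact: cv]. Qed.

(** The truncated transforms are linear exactly, and the error of the combination
    is the combination of the errors, so its L^2 norm tends to 0. *)
Lemma is_fourier_lin (u v : R -> R) (g k : R -> R[i]) (a b : R) : continuous u -> continuous v ->
  is_fourier u g -> is_fourier v k ->
  is_fourier (fun x => a * u x + b * v x)
    (fun xi => Complex (a * complex.Re (g xi) + b * complex.Re (k xi))
                       (a * complex.Im (g xi) + b * complex.Im (k xi))).
Proof.
move=> cu cv [mgr mgi fu] [mkr mki fv].
have cw : continuous (fun x => a * u x + b * v x).
  exact: continuous_lin.
have mr : measurable_fun [set: R] (fun xi => a * complex.Re (g xi) + b * complex.Re (k xi)).
  by apply: measurable_funD; exact: measurable_funM.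
have mi : measurable_fun [set: R] (fun xi => a * complex.Im (g xi) + b * complex.Im (k xi)).
  by apply: measurable_funD; exact: measurable_funM.
pose h xi := Complex (a * complex.Re (g xi) + b * complex.Re (k xi))
                     (a * complex.Im (g xi) + b * complex.Im (k xi)).
split; [exact: mr|exact: mi|].
apply: ereal_cvg0 => [n|e e0]; first exact: L2_norm_ge0.
pose c : R := 2 * (`|a| + `|b|).
have c0 : 0 <= c by rewrite mulr_ge0// addr_ge0.
have e1 : 0 < e / (c + 1) by rewrite divr_gt0// ltr_wpDl.
apply: filterS2 (L2_norm_cvg0 _ _ e1 fu) (L2_norm_cvg0 _ _ e1 fv) => n hu hv.
apply/L2_norm_leP; first exact: ltW.
have trE xi : fourier_trunc (fun x => a * u x + b * v x) n xi =
  Complex (a * complex.Re (fourier_trunc u n xi) + b * complex.Re (fourier_trunc v n xi))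
          (a * complex.Im (fourier_trunc u n xi) + b * complex.Im (fourier_trunc v n xi)).
  rewrite /fourier_trunc/=.
  have mI : measurable (`[- n%:R, n%:R]%classic : set (measurableTypeR R)) by exact: measurable_itv.
  have iuc := integrable_mul_cos u (- n%:R) n%:R xi cu.
  have ivc := integrable_mul_cos v (- n%:R) n%:R xi cv.
  have ius := integrable_mul_sin u (- n%:R) n%:R xi cu.
  have ivs := integrable_mul_sin v (- n%:R) n%:R xi cv.
  rewrite !mulrN -opprD.
  rewrite -(RintegralZl a mI iuc) -(RintegralZl b mI ivc) -(RintegralZl a mI ius) -(RintegralZl b mI ivs).
  rewrite -(RintegralD mI (integrable_scale _ _ _ _ _ _ mI iuc) (integrable_scale _ _ _ _ _ _ mI ivc)).
  rewrite -(RintegralD mI (integrable_scale _ _ _ _ _ _ mI ius) (integrable_scale _ _ _ _ _ _ mI ivs)).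
  by congr (Complex _ (- _)); apply: eq_Rintegral => y _; ring.
have := sq_integral_lin _ _ _ a b _ (measurable_trunc_err u g n cu mgr mgi)
  (measurable_trunc_err v k n cv mkr mki) (measurable_trunc_err _ h n cw mr mi) _ hu hv.
move=> /(_ _)/le_trans; apply.
- move=> xi; rewrite trE /h.
  case: (fourier_trunc u n xi) => p1 q1; case: (fourier_trunc v n xi) => p2 q2.
  case: (g xi) => p3 q3; case: (k xi) => p4 q4 /=.
  rewrite !sqr_sqrtr ?addr_ge0 ?sqr_ge0//.
  have := sqr_ge0 (a * (p1 - p3) - b * (p2 - p4)).
  have := sqr_ge0 (a * (q1 - q3) - b * (q2 - q4)).
  lra.
- rewrite lee_fin -/c ler_sqr ?nnegrE ?mulr_ge0 ?(ltW e0) ?(ltW e1)//.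
  rewrite mulrCA ger_pMr// ler_pdivrMr ?ltr_wpDl// mul1r lerDl//.
  by rewrite invr_ge0 addr_ge0.
Qed.

(** Membership in H^s without the finiteness of the norm. This part is stable
    under linear combinations, which gives access to the Sobolev bounds for a
    difference quotient in time, of which only the H^s norm is controlled. *)
Definition fourier_regular (u : R -> R) : Prop :=
  [/\ continuous u, sq_integrable u & is_fourier u (fourier u)].

Lemma in_Hs_regular (s : R) (u : R -> R) : in_Hs s u -> fourier_regular u.
Proof. by case=> ? ? ? _; split. Qed.

Lemma fourier_regular_lin (u v : R -> R) (a b : R) : fourier_regular u -> fourier_regular v ->
  fourier_regular (fun x => a * u x + b * v x).
Proof.
move=> [cu su fu] [cv sv fv]; split.
- exact: continuous_lin.
- exact: sq_integrable_lin.
- rewrite /fourier; apply: (xgetPex (fun=> 0)).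
  by eexists; exact: (is_fourier_lin _ _ _ _ _ _ cu cv fu fv).
Qed.

(** * Decay at infinity *)

Lemma Rintegral_disjoint_le (f : R -> R) (A B : set R) :
  measurable (A : set (measurableTypeR R)) -> measurable (B : set (measurableTypeR R)) -> [disjoint A & B] ->
  leb.-integrable [set: R] (EFin \o f) -> (forall x, 0 <= f x) ->
  \int[leb]_(x in A) f x + \int[leb]_(x in B) f x <= \int[leb]_x f x.
Proof.
move=> mA mB AB fi f0.
have mAB : measurable (A `|` B : set (measurableTypeR R)) by exact: measurableU.
rewrite -Rintegral_setU//; first exact: Rintegral_subset_le.
exact: (integrableS measurableT mAB _ fi).
Qed.

(** If |u x| > e, then |u| is at least e / 2 on an interval around x whose length
    depends on e and L only, and u^2 has a mass bounded below there. Far out the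
    tail of the integral of u^2 does not leave room for that. *)
Lemma lipschitz_L2_vanishes (u : R -> R) (L e : R) : 0 < e ->
  (forall x y, `|u x - u y| <= L * `|x - y|) ->
  leb.-integrable [set: R] (EFin \o (fun x => u x ^+ 2)) ->
  exists R0 : R, forall x, R0 <= `|x| -> `|u x| <= e.
Proof.
move=> e0 Lu iu.
pose L1 : R := `|L| + 1.
have L10 : 0 < L1 by rewrite ltr_wpDl.
have {}Lu x y : `|u x - u y| <= L1 * `|x - y|.
  apply: le_trans (Lu x y) _; apply: ler_wpM2r => //.
  by apply: le_trans (ler_norm L) _; rewrite lerDl.
pose eta : R := e / (2 * L1).
have eta0 : 0 < eta by rewrite divr_gt0// mulr_gt0.
pose delta : R := (2 * eta) * (e / 2) ^+ 2.
have delta0 : 0 < delta by apply: mulr_gt0; [exact: mulr_gt0|rewrite exprn_gt0// divr_gt0].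
have /cvgrPdist_lt/(_ _ delta0)[n _ /(_ n (leqnn n))/= hn] := cvg_Rintegral_growing _ iu.
(* The interval of radius eta around x is then disjoint from [-n, n]. *)
exists (n%:R + eta + 1) => x xR; rewrite leNgt; apply/negP => eux.
have mI : measurable (`[- n%:R, n%:R]%classic : set (measurableTypeR R)) by exact: measurable_itv.
have mJ : measurable (`[x - eta, x + eta]%classic : set (measurableTypeR R)) by exact: measurable_itv.
have := Rintegral_disjoint_le _ _ _ mI mJ _ iu (fun x => sqr_ge0 (u x)).
have dIJ : [disjoint (`[- n%:R, n%:R]%classic : set R) & (`[x - eta, x + eta]%classic : set R)].
  apply/disj_setPS => y /=; rewrite !in_itv/= => -[yn yx].
  move: xR; rewrite leNgt => /negP; apply.
  have : `|y| <= n%:R by rewrite ler_norml.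
  have : `|x - y| <= eta by rewrite ler_norml; lra.
  have := ler_normD (x - y) y; rewrite subrK; lra.
move/(_ dIJ).
have : delta <= \int[leb]_(y in `[x - eta, x + eta]) (u y ^+ 2).
  have -> : delta = \int[leb]_(y in `[x - eta, x + eta]) ((e / 2) ^+ 2).
    rewrite Rintegral_cst//= lebesgue_measure_itv/= lte_fin ifT/=; last by lra.
    by rewrite /delta mulrC; congr (_ * _); ring.
  apply: le_Rintegral => //.
  - by apply: continuous_integrable_segment => ?; exact: cvg_cst.
  - exact: (integrableS measurableT mJ _ iu).
  - move=> y; rewrite /= in_itv/= => yx.
    rewrite -(real_normK (num_real (u y))) ler_sqr ?nnegrE//; last by rewrite divr_ge0// ltW.
    have : `|u x - u y| <= e / 2.
      apply: le_trans (Lu x y) _.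
      apply: (@le_trans _ _ (L1 * eta)).
        apply: ler_wpM2l; first exact: ltW.
        by rewrite ler_norml; lra.
      by rewrite /eta (_ : _ * _ = e / 2)//; field; rewrite gt_eqF.
    have := ler_normD (u x - u y) (u y); rewrite subrK; lra.
move: hn; rewrite ltr_norml; lra.
Qed.

End sobolev.

(** * Time regularity: from the H^s norm to pointwise estimates *)

Section time_regularity.
Context {R : realType}.

(** The Sobolev bounds, applied to the difference quotient minus its limit. *)
Lemma C1_Hs_local (s T : R) (u ut : R -> R -> R) : 2 <= s -> C1_Hs_with s T u ut ->
  forall t, t \in `[0, T] -> forall e : R, 0 < e ->
  \forall r \near within `[0, T] t^',
   (forall x, `|(r - t)^-1 * (u r x - u t x) - ut t x| <= e) /\
   (forall x y, `|((r - t)^-1 * (u r x - u t x) - ut t x) - ((r - t)^-1 * (u r y - u t y) - ut t y)| <= e * `|x - y|).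
Proof.
move=> s2 [hu hut hd _] t tT e e0.
have C0 := (@sobolev_const_gt0 R).
have e1 : 0 < e / sobolev_const by rewrite divr_gt0.
have := ereal_cvg0_lt _ _ _ _ _ e1 (hd t tT) => /(_ _).
rewrite !near_withinE; apply: filterS => r hr rt rT.
have {}hr := ltW (hr rt rT).
have Rr := in_Hs_regular s _ (hu r rT); have Rt := in_Hs_regular s _ (hu t tT).
have Rut := in_Hs_regular s _ (hut t tT).
pose w x := (r - t)^-1 * (u r x - u t x) - ut t x.
have Rw : fourier_regular w.
  rewrite (_ : w = fun x => 1 * ((r - t)^-1 * u r x + (- (r - t)^-1) * u t x) + (- 1) * ut t x).
    have Rd := fourier_regular_lin (u r) (u t) (r - t)^-1 (- (r - t)^-1) Rr Rt.
    exact: (fourier_regular_lin _ (ut t) 1 (- 1) Rd Rut).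
  by apply/funext => x; rewrite /w; ring.
have [cw sw fw] := Rw.
have E : e = sobolev_const * (e / sobolev_const) by rewrite mulrC divfK// gt_eqF.
split; first by move=> x; rewrite [leRHS]E; exact: (sobolev_sup s _ w).
by move=> x y; rewrite [X in _ <= X * _]E; exact: (sobolev_lipschitz s _ w).
Qed.

Lemma C1_Hs_time_derivative (s T : R) (u ut : R -> R -> R) : 2 <= s -> C1_Hs_with s T u ut ->
  forall t, t \in `[0, T] -> forall x,
  (r - t)^-1 * (u r x - u t x) @[r --> within `[0, T] t^'] --> ut t x.
Proof.
move=> s2 hC t tT x; apply/cvgrPdist_le => e e0.
apply: filterS (C1_Hs_local _ _ _ _ s2 hC t tT e e0) => r [h _].
by rewrite distrC; exact: h.
Qed.

Lemma C1_Hs_near (s T : R) (u ut : R -> R -> R) : 2 <= s -> C1_Hs_with s T u ut ->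
  forall t, t \in `[0, T] -> exists2 A : R, 0 < A &
  \forall r \near t, r \in `[0, T] ->
   (forall x, `|u r x - u t x| <= `|r - t| * A) /\
   (forall x y, `|(u r x - u t x) - (u r y - u t y)| <= `|r - t| * A * `|x - y|).
Proof.
move=> s2 hC t tT; have [hu hut _ _] := hC.
have [cut sut fut fin] := hut t tT.
have [b b0 hb] : exists2 b : R, 0 < b & (Hs_norm s (ut t) <= b%:E)%E.
  have : (0 <= Hs_norm s (ut t))%E by exact: L2_norm_ge0.
  case: (Hs_norm s (ut t)) fin => [b| |]// _; rewrite lee_fin => b0.
  by exists (b + 1); [rewrite ltr_wpDl|rewrite lee_fin lerDl].
pose A : R := sobolev_const * b + 1.
have A0 : 0 < A by rewrite ltr_wpDl// mulr_ge0 ?(ltW b0)// ltW// (@sobolev_const_gt0 R).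
exists A => //.
have := C1_Hs_local _ _ _ _ s2 hC t tT 1 ltr01.
rewrite !near_withinE; apply: filterS => r hr rT.
have [->|rt] := eqVneq r t.
  by split => [x|x y]; rewrite !subrr ?subr0 normr0 ?mul0r.
have [h1 h2] := hr rt rT.
have rt0 : r - t != 0 by rewrite subr_eq0.
split.
- move=> x.
  have -> : u r x - u t x = (r - t) * (((r - t)^-1 * (u r x - u t x) - ut t x) + ut t x).
    by rewrite subrK mulVKf.
  rewrite normrM ler_wpM2l//; apply: le_trans (ler_normD _ _) _.
  rewrite /A addrC lerD//; exact: (sobolev_sup s b (ut t)).
- move=> x y.
  have -> : u r x - u t x - (u r y - u t y) = (r - t) *
     (((r - t)^-1 * (u r x - u t x) - ut t x - ((r - t)^-1 * (u r y - u t y) - ut t y)) + (ut t x - ut t y)).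
    by field.
  rewrite normrM -mulrA ler_wpM2l//; apply: le_trans (ler_normD _ _) _.
  rewrite /A mulrDl addrC lerD//; exact: (sobolev_lipschitz s b (ut t)).
Qed.

(** Compactness of [0, T], for a property that is monotone in the constant M: a
    constant that works near every t can be chosen uniformly. *)
Lemma segment_uniform (T : R) (P : R -> R -> Prop) :
  (forall t, t \in `[0, T] -> exists2 M : R, 0 < M &
     \forall r \near t, r \in `[0, T] -> forall M', M <= M' -> P M' r) ->
  exists2 M : R, 0 < M & forall t, t \in `[0, T] -> P M t.
Proof.
move=> h.
have := (compact_near_coveringP _).1 (@segment_compact R 0 T).
move=> /(_ R +oo (fun M t => t \in `[0, T] -> P M t) _) cov.
have {}cov : \forall M \near +oo, `[0, T] `<=` (fun t => t \in `[0, T] -> P M t).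
  apply: cov => t /= tT; have [M M0 hM] := h t tT.
  exists ([set r | r \in `[0, T] -> forall M', M <= M' -> P M' r], [set M' | M <= M']).
    by split => //; exact: (nbhs_pinfty_ge (num_real M)).
  by move=> [r M'] /= [h1 h2] rT; exact: h1.
have : \forall M \near +oo, 0 < M :> R by exact: (nbhs_pinfty_gt (num_real 0)).
move=> /(filterI cov) /filter_ex[M [hM M0]].
by exists M => // t tT; exact: hM.
Qed.

Lemma C1_Hs_uniform (s T : R) (u ut : R -> R -> R) : 2 <= s -> C1_Hs_with s T u ut ->
  exists2 M : R, 0 < M & forall t, t \in `[0, T] ->
   (forall x, `|u t x| <= M) /\ (forall x y, `|u t x - u t y| <= M * `|x - y|).
Proof.
move=> s2 hC; apply: segment_uniform => t tT.
have [hu _ _ _] := hC.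
have [A A0 hA] := C1_Hs_near _ _ _ _ s2 hC t tT.
have [cut sut fut fin] := hu t tT.
have [b b0 hb] : exists2 b : R, 0 < b & (Hs_norm s (u t) <= b%:E)%E.
  have : (0 <= Hs_norm s (u t))%E by exact: L2_norm_ge0.
  case: (Hs_norm s (u t)) fin => [b| |]// _; rewrite lee_fin => b0.
  by exists (b + 1); [rewrite ltr_wpDl|rewrite lee_fin lerDl].
have C0 := (@sobolev_const_gt0 R).
exists (sobolev_const * b + A); first by rewrite addr_gt0// mulr_gt0.
have n1 : \forall r \near t, `|r - t| <= 1.
  by apply/nbhs_ballP; exists 1 => //= r; rewrite /ball/= distrC => /ltW.
apply: filterS2 hA n1 => r hr r1 rT M' MM.
have [h1 h2] := hr rT.
split => [x|x y].
  apply: le_trans MM; rewrite -(subrK (u t x) (u r x)) addrC.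
  apply: le_trans (ler_normD _ _) _; apply: lerD.
    exact: (sobolev_sup s b (u t)).
  apply: le_trans (h1 x) _. by rewrite ler_piMl// ltW.
apply: le_trans (ler_wpM2r (normr_ge0 _) MM).
have -> : u r x - u r y = (u t x - u t y) + (u r x - u t x - (u r y - u t y)) by ring.
apply: le_trans (ler_normD _ _) _; rewrite mulrDl; apply: lerD.
  exact: (sobolev_lipschitz s b (u t)).
apply: le_trans (h2 x y) _. rewrite -mulrA ler_piMl// mulr_ge0// ltW//.
Qed.

(** The profile u t vanishes at infinity for each t, and by [C1_Hs_near] the
    profiles at nearby times are uniformly close, so one radius serves a
    neighbourhood of t. *)
Lemma C1_Hs_vanishes (s T : R) (u ut : R -> R -> R) : 2 <= s -> C1_Hs_with s T u ut ->
  forall e : R, 0 < e -> exists2 R0 : R, 0 < R0 & forall t, t \in `[0, T] ->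
   forall x, R0 <= `|x| -> `|u t x| <= e.
Proof.
move=> s2 hC e e0; apply: segment_uniform => t tT.
have [M M0 hM] := C1_Hs_uniform _ _ _ _ s2 hC.
have [hu _ _ _] := hC.
have [A A0 hA] := C1_Hs_near _ _ _ _ s2 hC t tT.
have [cut sut fut _] := hu t tT.
have e2 : 0 < e / 2 by rewrite divr_gt0.
have [R1 hR1] := lipschitz_L2_vanishes (u t) M (e / 2) e2 (hM t tT).2 (sq_integrable_integrable _ sut).
exists (`|R1| + 1); first by rewrite ltr_wpDl.
have eA : 0 < e / 2 / A by rewrite divr_gt0.
have n1 : \forall r \near t, `|r - t| <= e / 2 / A.
  by apply/nbhs_ballP; exists (e / 2 / A) => //= r; rewrite /ball/= distrC => /ltW.
apply: filterS2 hA n1 => r hr r1 rT M' MM x xM.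
have [h1 _] := hr rT.
have xR : R1 <= `|x|.
  by apply: le_trans xM; apply: le_trans MM; apply: le_trans (ler_norm _) _; rewrite lerDl.
have := hR1 x xR.
have : `|u r x - u t x| <= e / 2.
  apply: le_trans (h1 x) _; by rewrite -ler_pdivlMr.
have := ler_normD (u r x - u t x) (u t x); rewrite subrK; lra.
Qed.

End time_regularity.

(** * Consistency of the grid sums *)

Section consistency.
Context {R : realType}.
Local Notation leb := (@lebesgue_measure R).

Lemma step_sum_point (h : R) (N : nat) (g : R -> R) (k : int) :
  \sum_(j < N.*2.+1) (idx j == k)%:R * g (grid h (idx j)) =
  if (`|k| <= N%:Z)%R then g (grid h k) else 0.
Proof.
have idxE (j : 'I_N.*2.+1) : `|idx j| <= N%:Z by rewrite /idx; have := ltn_ord j; lia.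
case: ifPn => kN.
  have jk : (absz (k + N%:Z)%R < N.*2.+1)%N by lia.
  rewrite (bigD1 (Ordinal jk))//= big1 ?addr0.
    have -> : idx (Ordinal jk) = k by rewrite /idx/=; lia.
    by rewrite eqxx mul1r.
  move=> j /eqP jne; rewrite (_ : (idx j == k) = false) ?mul0r//.
  apply/eqP => jk'; apply: jne; apply: val_inj => /=.
  by move: jk'; rewrite /idx; lia.
rewrite big1// => j _; rewrite (_ : (idx j == k) = false) ?mul0r//.
by apply/eqP => jk; have := idxE j; rewrite jk; move/negP: kN; lia.
Qed.

(** A grid point outside the window is missing from the sum, but there g is at
    most eta. *)
Lemma step_point_le (h : R) (N : nat) (g : R -> R) (L eta w : R) (k : int) : 0 < h -> 0 <= eta ->
  (forall y z, `|g y - g z| <= L * `|y - z|) ->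
  (forall y, N%:R * h <= `|y| -> `|g y| <= eta) ->
  `|g w - \sum_(j < N.*2.+1) (idx j == k)%:R * g (grid h (idx j))| <= L * `|w - grid h k| + eta.
Proof.
move=> h0 eta0 gL geta; rewrite step_sum_point.
have gw := gL w (grid h k).
case: ifPn => kN; first by apply: le_trans gw _; rewrite lerDl.
rewrite subr0 -(subrK (g (grid h k)) (g w)); apply: le_trans (ler_normD _ _) _.
apply: lerD => //; apply: geta.
rewrite /grid normrM (gtr0_norm h0) ler_pM2r// -intr_norm -[N%:R]/(N%:Z%:~R) ler_int.
by move: kN; lia.
Qed.

(** A point w lies in exactly two of the intervals of length 2 h centred at grid
    points, those of the neighbours floor (w / h) and floor (w / h) + 1. *)
Lemma step_indicator (h w : R) (a : int) : 0 < h ->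
  ((grid h a - h <= w < grid h a + h)%R : bool)%:R =
  (a == Num.floor (w / h))%:R + (a == Num.floor (w / h) + 1)%:R :> R.
Proof.
move=> h0.
set k := Num.floor (w / h).
have kw : k%:~R <= w / h < (k + 1)%:~R by rewrite real_floor_itv// num_real.
have -> : (grid h a - h <= w < grid h a + h) = ((a == k) || (a == k + 1)).
  have -> : (grid h a - h <= w < grid h a + h) = ((a - 1)%:~R <= w / h < (a + 1)%:~R).
    by rewrite ler_pdivlMr// ltr_pdivrMr// /grid !rmorphB !rmorphD/= mulrBl mulrDl mul1r.
  apply/idP/idP.
    move=> /andP[h1 h2]; move: kw => /andP[k1 k2].
    have : a - 1 < k + 1 by rewrite -(ltr_int R); exact: le_lt_trans h1 k2.
    have : k < a + 1 by rewrite -(ltr_int R); exact: le_lt_trans k1 h2.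
    lia.
  move=> /orP[] /eqP ->; move: kw => /andP[k1 k2]; apply/andP; split => //.
  - by apply: le_trans k1; rewrite ler_int; lia.
  - by rewrite addrK.
  - by apply: lt_trans k2 _; rewrite ltr_int; lia.
have : ~~ ((a == k) && (a == k + 1)) by apply/negP => /andP[/eqP -> /eqP]; lia.
by case: (a == k); case: (a == k + 1) => //= _; rewrite ?addr0 ?add0r.
Qed.

(** By [step_indicator] the sum is the mean of g over the two grid neighbours of
    x - z, as far as these belong to the window. Their distances to x - z add up
    to h. *)
Lemma step_approx (h : R) (N : nat) (g : R -> R) (L eta x z : R) : 0 < h -> 0 <= eta ->
  (forall y z, `|g y - g z| <= L * `|y - z|) ->
  (forall y, N%:R * h <= `|y| -> `|g y| <= eta) ->
  `|g (x - z) - \sum_(j < N.*2.+1) 2^-1 * \1_(`]x - grid h (idx j) - h, x - grid h (idx j) + h]%classic) z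
      * g (grid h (idx j))| <= L * h + eta.
Proof.
move=> h0 eta0 gL geta.
pose w := x - z; pose k := Num.floor (w / h).
have kw : k%:~R <= w / h < (k + 1)%:~R by rewrite real_floor_itv// num_real.
move: kw; rewrite ler_pdivlMr// ltr_pdivrMr// rmorphD/= mulrDl mul1r -/(grid h k) => /andP[k1 k2].
rewrite (eq_bigr (fun j => 2^-1 * ((idx j == k)%:R * g (grid h (idx j))) +
   2^-1 * ((idx j == k + 1)%:R * g (grid h (idx j))))); last first.
  move=> j _; rewrite -mulrDr -mulrDl -step_indicator// mulrA indicE.
  congr (_ * _%:R * _); congr nat_of_bool.
  by apply/idP/idP; rewrite !inE/= !in_itv/= /w; lra.
rewrite big_split/= -!mulr_sumr.
have L0 : 0 <= L.
  by have := gL 1 0; rewrite subr0 normr1 mulr1; exact: le_trans.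
have h1 := step_point_le h N g L eta w k h0 eta0 gL geta.
have h2 := step_point_le h N g L eta w (k + 1) h0 eta0 gL geta.
have e1 : `|w - grid h k| = w - grid h k by rewrite ger0_norm; lra.
have e2 : `|w - grid h (k + 1)| = grid h k + h - w.
  by rewrite /grid rmorphD/= mulrDl mul1r -/(grid h k) ler0_norm; lra.
move: h1 h2; rewrite e1 e2 -/w.
set S1 := \sum_(j < _) _; set S2 := \sum_(j < _) _ => h1 h2.
have -> : g w - (2^-1 * S1 + 2^-1 * S2) = 2^-1 * (g w - S1) + 2^-1 * (g w - S2) by field.
apply: le_trans (ler_normD _ _) _; rewrite !normrM ger0_norm; last by rewrite invr_ge0.
have -> : L * h = L * (w - grid h k) + L * (grid h k + h - w) by ring.
have : 0 <= L * (w - grid h k) by rewrite mulr_ge0// subr_ge0.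
have : 0 <= L * (grid h k + h - w) by rewrite mulr_ge0// subr_ge0 ltW.
move: h1 h2; set p := L * (w - _); set q := L * (_ - w).
set n1 := `|_|; set n2 := `|_| => h1 h2 p0 q0; lra.
Qed.

Lemma Rintegral_sum d (T : measurableType d) (nu : {measure set T -> \bar R}) (n : nat) (f : 'I_n -> T -> R) :
  (forall i, nu.-integrable [set: T] (EFin \o f i)) ->
  nu.-integrable [set: T] (EFin \o (fun x => \sum_(i < n) f i x)) /\
  \int[nu]_x \sum_(i < n) f i x = \sum_(i < n) \int[nu]_x f i x.
Proof.
elim: n f => [|n IH] f fi.
  under eq_Rintegral do rewrite big_ord0.
  rewrite big_ord0 Rintegral_cst// mul0r; split => //.
  under [X in _ \o X]eq_fun do rewrite big_ord0.
  exact: integrable0.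
have [i1 E1] := IH (fun i => f (widen_ord (leqnSn n) i)) (fun i => fi _).
split.
  under [X in _ \o X]eq_fun do rewrite big_ord_recr/=.
  exact: (integrable_add _ _ _ _ _ _ measurableT i1 (fi ord_max)).
rewrite big_ord_recr/= -E1 -(RintegralD measurableT i1 (fi ord_max)).
by apply: eq_Rintegral => x _; rewrite big_ord_recr.
Qed.

Lemma le_abs_Rintegral_cst d (T : measurableType d) (nu : {measure set T -> \bar R}) (D : set T) (f : T -> R) (c : R) :
  measurable D -> (nu D < +oo)%E -> nu.-integrable D (EFin \o f) -> (forall x, D x -> `|f x| <= c) ->
  `|\int[nu]_(x in D) f x| <= c * fine (nu D).
Proof.
move=> mD nD fi fc.
rewrite -Rintegral_cst//; apply: le_trans (le_normr_Rintegral mD fi) _.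
apply: le_Rintegral => //; first exact: (integrable_norm_fun _ _ _ _ _ fi).
apply: measurable_bounded_integrable => //.
by exists `|c|; split; [exact: num_real|move=> M cM x _ /=; exact: ltW].
Qed.

Lemma measurable_Rintegral_section d1 d2 (T1 : measurableType d1) (T2 : measurableType d2)
    (m1 : {sigma_finite_measure set T1 -> \bar R})
    (m2 : {sigma_finite_measure set T2 -> \bar R}) (F : T1 * T2 -> R) :
  (m1 \x m2)%E.-integrable [set: T1 * T2] (EFin \o F) ->
  (forall y, m1.-integrable [set: T1] (fun x => (F (x, y))%:E)) ->
  measurable_fun [set: T2] (fun y => \int[m1]_x F (x, y)).
Proof.
move=> iF i1; apply/measurable_EFinP.
have := measurable_fubini_G iF; apply: eq_measurable_fun => y _.
by rewrite /= fineK//; exact: integrable_fin_num.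
Qed.

(** The positive and the negative part of mu are treated separately, as finite
    measures nu with distribution function B. *)
Section finite_measure_kernel.
Variable nu : {finite_measure set (measurableTypeR R) -> \bar R}.
Let V : R := fine (nu [set: R]).
Let B (x : R) : R := fine (nu `]-oo, x]%classic).

Let mI (a b : R) : measurable (`]a, b]%classic : set (measurableTypeR R)).
Proof. exact: measurable_itv. Qed.

Let nu_fin (A : set R) : measurable (A : set (measurableTypeR R)) -> (nu A < +oo)%E.
Proof.
by move=> mA; rewrite ltey_eq; apply/orP; left; exact: fin_num_measure.
Qed.

Lemma cdf_sub (a b : R) : a <= b -> B b - B a = fine (nu `]a, b]%classic).
Proof.
move=> ab; rewrite /B.
have mA : measurable (`]-oo, a]%classic : set (measurableTypeR R)) by exact: measurable_itv.
have -> : `]-oo, b]%classic = (`]-oo, a]%classic : set (measurableTypeR R)) `|` `]a, b]%classic.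
  apply/seteqP; split => x /=; rewrite !in_itv/=; last by lra.
  by case: (leP x a) => h1 h2; [left|right; rewrite h2].
rewrite measureU//; last first.
  by apply/seteqP; split => x //=; rewrite !in_itv/= => -[h1 /andP[h2 _]]; lra.
rewrite fineD ?fin_num_measure//.
by rewrite addrC addKr.
Qed.

Lemma cdf_ge0 (x : R) : 0 <= B x.
Proof. by rewrite fine_ge0. Qed.

Lemma cdf_le (x : R) : B x <= V.
Proof.
have mA : measurable (`]-oo, x]%classic : set (measurableTypeR R)) by exact: measurable_itv.
by rewrite fine_le ?fin_num_measure// le_measure ?inE.
Qed.

Lemma cdf_mono (a b : R) : a <= b -> B a <= B b.
Proof. by move=> ab; rewrite -subr_ge0 cdf_sub// fine_ge0. Qed.

Let V0 : 0 <= V. Proof. by rewrite fine_ge0. Qed.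

Section kernel_fubini.
Variables (g : R -> R) (G L x delta : R).
Hypothesis gG : forall y, `|g y| <= G.
Hypothesis gL : forall y z, `|g y - g z| <= L * `|y - z|.
Hypothesis cg : continuous g.
Hypothesis delta0 : 0 < delta.

Let F (p : measurableTypeR R * measurableTypeR R) : R := g p.1 * \1_(`]x, x + delta]%classic) (p.1 + p.2).

Let mg : measurable_fun [set: measurableTypeR R] g.
Proof. exact: continuous_measurable_fun. Qed.

Let mF : measurable_fun setT F.
Proof.
apply: measurable_funM; first exact: measurableT_comp.
have h : measurable_fun [set: measurableTypeR R] (\1_(`]x, x + delta]%classic : set (measurableTypeR R)) : measurableTypeR R -> R).
  exact: measurable_indic.
have k : measurable_fun (U := measurableTypeR R) [set: measurableTypeR R * measurableTypeR R] (fun p => p.1 + p.2).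
  exact: measurable_funD.
exact: (measurableT_comp h k).
Qed.

Let Fy z y : F (y, z) = (g \_ (`]x - z, x + delta - z]%classic)) y.
Proof.
rewrite /F/= indicE patchE.
have -> : (y + z \in `]x, x + delta]%classic) = (y \in `]x - z, x + delta - z]%classic).
  by apply/idP/idP; rewrite !inE/= !in_itv/=; lra.
by case: ifP => _; rewrite ?mulr1 ?mulr0.
Qed.

Let Fz z y : F (y, z) = g y * \1_(`]x - y, x + delta - y]%classic) z.
Proof.
rewrite /F/= !indicE; congr (_ * _%:R); congr nat_of_bool.
by apply/idP/idP; rewrite !inE/= !in_itv/=; lra.
Qed.

Let G0 : 0 <= G. Proof. by apply: le_trans (gG 0). Qed.

Let lebI (z : R) : leb (`]x - z, x + delta - z]%classic : set R) = delta%:E.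
Proof.
by rewrite /= lebesgue_measure_itv/= lte_fin ltrD2r ltrDl delta0/= -EFinB; congr EFin; ring.
Qed.

Let lebI_fin (z : R) : Order.lt (leb (`]x - z, x + delta - z]%classic : set R)) +oo%E.
Proof. by rewrite lebI ltry. Qed.

Let bound_itv (a b : R) (h : R -> R) : (forall y, `|h y| <= G) -> measurable_fun [set: R] h ->
  leb.-integrable `]a, b] (EFin \o h).
Proof.
move=> hG mh; apply: measurable_bounded_integrable => //.
- by rewrite /= lebesgue_measure_itv/=; case: ifP => _; rewrite ?ltry.
- exact: measurable_funTS.
- by exists G; split; [exact: num_real|move=> M GM y _ /=; exact: le_trans (hG y) (ltW GM)].
Qed.

Let iFy z : leb.-integrable [set: R] (fun y => (F (y, z))%:E).
Proof.
under eq_fun do rewrite Fy.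
rewrite -[X in integrable _ _ X]/(EFin \o (g \_ `]x - z, x + delta - z]%classic)) -restrict_EFin.
apply/(integrable_mkcond _ (mI _ _)).
exact: bound_itv.
Qed.

Let iFz y : nu.-integrable [set: R] (fun z => (F (y, z))%:E).
Proof.
apply: (@measurable_bounded_integrable _ _ _ _ (fun z => F (y, z))) => //.
- exact: nu_fin.
- by apply: measurableT_comp => //.
- exists G; split; [exact: num_real|move=> M GM z _ /=].
  apply: le_trans (ltW GM); rewrite normrM -[G]mulr1 ler_pM// indicE.
  by case: (_ \in _); rewrite ?normr1 ?normr0.
Qed.

Let iF : (leb \x nu)%E.-integrable [set: measurableTypeR R * measurableTypeR R] (EFin \o F).
Proof.
apply/integrable21ltyP; first exact/measurable_EFinP.
apply: (@le_lt_trans _ _ (\int[nu]_z (G * delta)%:E)%E); last first.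
  rewrite integral_cst// lte_mul_pinfty// ?nu_fin// lee_fin mulr_ge0// ltW//.
apply: ge0_le_integral => //.
- by move=> z _; apply: integral_ge0.
- apply: (measurable_fun_fubini_tonelli_G (abse \o (EFin \o F))) => //.
    by apply: measurableT_comp => //; exact/measurable_EFinP.
  by move=> p; exact: abse_ge0.
- move=> z _.
  pose I := `]x - z, x + delta - z]%classic : set R.
  have -> : (\int[leb]_y `|(EFin \o F) (y, z)| = \int[leb]_(y in I) (`|g y|%R)%:E)%E.
    rewrite [RHS]integral_mkcond; apply: eq_integral => y _.
    by rewrite /= Fy !patchE; case: ifP => // _; rewrite normr0.
  have -> : (G * delta)%:E = (\int[leb]_(y in I) G%:E)%E.
    have lI : leb I = delta%:E by exact: lebI.
    rewrite integral_cst; last exact: mI.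
    by rewrite EFinM; congr (_ * _)%E; exact/esym/lI.
  apply: ge0_le_integral => //=.
  - exact: mI.
  - by apply/measurable_EFinP; apply: measurable_funTS; apply: measurableT_comp.
  - by move=> y _; rewrite lee_fin.
Qed.

(** Increments of the distribution function are masses, B (x + delta - y) -
    B (x - y) being the nu-mass of ]x - y, x + delta - y]; exchanging the order
    of integration turns the increment of a convolution into averages of g
    over windows of length delta. *)
Lemma kernel_fubini :
  leb.-integrable [set: R] (EFin \o (fun y => (B (x + delta - y) - B (x - y)) * g y)) /\
  \int[leb]_y ((B (x + delta - y) - B (x - y)) * g y) =
  \int[nu]_z \int[leb]_(y in `]x - z, x + delta - z]) g y /\
  nu.-integrable [set: R] (EFin \o (fun z => \int[leb]_(y in `]x - z, x + delta - z]) g y)).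
Proof.
have E1 y : \int[nu]_z F (y, z) = (B (x + delta - y) - B (x - y)) * g y.
  under eq_Rintegral do rewrite Fz.
  have ii : nu.-integrable [set: R] (EFin \o (\1_(`]x - y, x + delta - y]%classic : set (measurableTypeR R)))).
    exact: integrable_indic.
  rewrite (RintegralZl (g y) measurableT ii) mulrC; congr (_ * _).
  rewrite cdf_sub; last by rewrite lerD2r lerDl ltW.
  by rewrite /Rintegral integral_indic// setIT.
have E2 z : \int[leb]_y F (y, z) = \int[leb]_(y in `]x - z, x + delta - z]) g y.
  rewrite [RHS]Rintegral_mkcond; apply: eq_Rintegral => y _; exact: Fy.
split; [|split].
- have := Rintegrable_fubini _ _ _ _ _ _ _ iF iFz.
  by under [X in _ \o X]eq_fun do rewrite E1.
- transitivity (\int[leb]_y \int[nu]_z F (y, z)).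
    by apply: eq_Rintegral => y _; rewrite E1.
  rewrite (Rintegral_Fubini _ _ _ _ _ _ _ iF iFz iFy).
  by apply: eq_Rintegral => z _; rewrite E2.
- have Gd z : `|\int[leb]_(y in `]x - z, x + delta - z]) g y| <= G * delta.
    rewrite -[in leRHS](_ : fine (leb (`]x - z, x + delta - z]%classic : set R)) = delta); last by rewrite lebI.
    by apply: le_abs_Rintegral_cst; [exact: mI|exact: lebI_fin|exact: bound_itv|].
  apply: measurable_bounded_integrable => //.
  + exact: nu_fin.
  + have := measurable_Rintegral_section _ _ _ _ _ _ _ iF iFy.
    rewrite (_ : (fun z => \int[leb]_y F (y, z)) = (fun z => \int[leb]_(y in `]x - z, x + delta - z]) g y))//.
    by apply/funext => z; exact: E2.
  + exists (G * delta); split; [exact: num_real|move=> M GM z _ /=].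
    exact: le_trans (Gd z) (ltW GM).
Qed.

Lemma kernel_average (z : R) :
  `|\int[leb]_(y in `]x - z, x + delta - z]) g y - delta * g (x - z)| <= L * delta * delta.
Proof.
have ld : fine (leb (`]x - z, x + delta - z]%classic : set R)) = delta by rewrite lebI.
have ig : leb.-integrable `]x - z, x + delta - z] (EFin \o g) by exact: bound_itv.
have fl := lebI_fin z.
have ic : leb.-integrable `]x - z, x + delta - z] (EFin \o (fun=> g (x - z))).
  apply: measurable_bounded_integrable => //.
  by exists `|g (x - z)|; split; [exact: num_real|move=> M GM y _ /=; exact: ltW].
have -> : delta * g (x - z) = \int[leb]_(y in `]x - z, x + delta - z]) g (x - z).
  by rewrite Rintegral_cst ?ld 1?mulrC//; exact: mI.
rewrite -(RintegralB (mI _ _) ig ic) -{3}ld.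
apply: le_abs_Rintegral_cst => //; first exact: integrable_sub.
move=> y /=; rewrite in_itv/= => yI.
have L0 : 0 <= L.
  by have := gL 1 0; rewrite subr0 normr1 mulr1; exact: le_trans.
apply: le_trans (gL _ _) _; apply: ler_wpM2l => //.
by rewrite ger0_norm; lra.
Qed.
End kernel_fubini.

(** The difference quotient of the convolution and the grid sum are both integrals
    against nu, of functions that approximate z |-> g (x - z) within L delta and
    L h + eta. *)
Lemma quotient_vs_sum (g : R -> R) (G L eta x delta h : R) (N : nat) : 0 < delta -> 0 < h -> 0 <= eta ->
  continuous g ->
  (forall y, `|g y| <= G) ->
  (forall y z, `|g y - g z| <= L * `|y - z|) ->
  (forall y, N%:R * h <= `|y| -> `|g y| <= eta) ->
  `|delta^-1 * \int[leb]_y ((B (x + delta - y) - B (x - y)) * g y)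
    - \sum_(j < N.*2.+1) 2^-1 * (B (x - grid h (idx j) + h) - B (x - grid h (idx j) - h)) * g (grid h (idx j))|
  <= (L * delta + (L * h + eta)) * V.
Proof.
move=> delta0 h0 eta0 cg gG gL geta.
have [_ [-> iK]] := kernel_fubini g G x delta gG cg delta0.
pose S j z := 2^-1 * \1_(`]x - grid h (idx j) - h, x - grid h (idx j) + h]%classic) z * g (grid h (@idx N j)).
have ii a b : nu.-integrable [set: R] (EFin \o (\1_(`]a, b]%classic : set (measurableTypeR R)))).
  exact: integrable_indic.
have iS j : nu.-integrable [set: R] (EFin \o S j).
  rewrite (_ : S j = fun z => (2^-1 * g (grid h (idx j))) *
     \1_(`]x - grid h (idx j) - h, x - grid h (idx j) + h]%classic) z).
    exact: (integrable_scale _ _ _ _ _ _ measurableT (ii _ _)).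
  by apply/funext => z; rewrite /S mulrAC.
have [iSS ES] := Rintegral_sum _ _ nu _ S iS.
rewrite (eq_bigr (fun j => \int[nu]_z S j z)); last first.
  move=> j _.
  transitivity (\int[nu]_z ((2^-1 * g (grid h (idx j))) *
     \1_(`]x - grid h (idx j) - h, x - grid h (idx j) + h]%classic) z)).
    rewrite (RintegralZl _ measurableT (ii _ _)) cdf_sub; last by lra.
    by rewrite /Rintegral integral_indic// setIT mulrAC.
  by apply: eq_Rintegral => z _; rewrite /S mulrAC.
rewrite -ES -(RintegralZl _ measurableT iK).
have iD := integrable_scale _ _ _ _ delta^-1 _ measurableT iK.
rewrite -(RintegralB measurableT iD iSS).
apply: le_abs_Rintegral_cst => //.
- exact: nu_fin.
- exact: integrable_sub.
move=> z _.
rewrite -(subrK (g (x - z)) (delta^-1 * _)) -addrA.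
apply: le_trans (ler_normD _ _) _; apply: lerD; last exact: step_approx.
have := kernel_average g G L x delta gG gL cg delta0 z.
have -> : \int[leb]_(y in `]x - z, x + delta - z]) g y - delta * g (x - z) =
  delta * (delta^-1 * \int[leb]_(y in `]x - z, x + delta - z]) g y - g (x - z)).
  by rewrite mulrBr mulVKf// gt_eqF.
by rewrite normrM (gtr0_norm delta0) -mulrA [L * _]mulrC -mulrA ler_pM2l// mulrC.
Qed.

(** The intervals of length 2 h around successive grid points overlap twice, which
    the factor 1 / 2 compensates: the sum telescopes in steps of two. *)
Lemma cdf_weights (h x : R) (N : nat) : 0 < h ->
  \sum_(j < N.*2.+1) 2^-1 * (B (x - grid h (idx j) + h) - B (x - grid h (@idx N j) - h)) <= V.
Proof.
move=> h0.
pose C (n : nat) := B (x - grid h (n%:Z - N%:Z) + h).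
have E (n : nat) : x - grid h (n%:Z - N%:Z) - h = x - grid h (n.+2%:Z - N%:Z) + h.
  by rewrite /grid !rmorphB/= -[n.+2]addn2 PoszD rmorphD/=; ring.
have tel m : \sum_(j < m) 2^-1 * (C j - C j.+2) = 2^-1 * (C 0%N + C 1%N - C m - C m.+1).
  elim: m => [|m IH]; first by rewrite big_ord0; ring.
  by rewrite big_ord_recr/= IH; ring.
rewrite (eq_bigr (fun j : 'I_N.*2.+1 => 2^-1 * (C j - C j.+2))); last first.
  by move=> j _; rewrite /C /idx E.
rewrite tel.
have C0 n : 0 <= C n by exact: cdf_ge0.
have CV n : C n <= V by exact: cdf_le.
have := C0 N.*2.+1; have := C0 N.*2.+2; have := CV 0%N; have := CV 1%N; lra.
Qed.

End finite_measure_kernel.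

Section charge_consistency.
Variables (beta : R -> R) (mu : {charge set (measurableTypeR R) -> \bar R}).
Hypothesis ibeta : leb.-integrable [set: R] (EFin \o beta).
Hypothesis betaE : forall x : R, (beta x)%:E = mu [set` `]-oo, x]].
Variables (P N : set (measurableTypeR R)) (muPN : hahn_decomposition mu P N).

Let np : {finite_measure set (measurableTypeR R) -> \bar R} := jordan_pos muPN.
Let nn : {finite_measure set (measurableTypeR R) -> \bar R} := jordan_neg muPN.
Let Bp (x : R) : R := fine (np `]-oo, x]%classic).
Let Bn (x : R) : R := fine (nn `]-oo, x]%classic).
Let V : R := fine (np [set: R]) + fine (nn [set: R]).

Lemma beta_jordan (x : R) : beta x = Bp x - Bn x.
Proof.
have mA : measurable (`]-oo, x]%classic : set (measurableTypeR R)) by exact: measurable_itv.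
apply: EFin_inj; rewrite betaE (jordan_decomp muPN mA) /Bp /Bn EFinB.
by rewrite !fineK ?fin_num_measure// /cadd/= /cscale EFinN mulN1e.
Qed.

Lemma variation_ge0 : 0 <= V.
Proof. by rewrite addr_ge0 ?fine_ge0. Qed.

Lemma grid_weightE (h : R) (i j : int) : 0 < h ->
  h * Dgrid h beta (i - j) =
  2^-1 * (Bp (grid h i - grid h j + h) - Bp (grid h i - grid h j - h)) -
  2^-1 * (Bn (grid h i - grid h j + h) - Bn (grid h i - grid h j - h)).
Proof.
move=> h0; rewrite /Dgrid.
have -> : grid h (i - j + 1) = grid h i - grid h j + h by rewrite /grid !rmorphD/= rmorphN/=; ring.
have -> : grid h (i - j - 1) = grid h i - grid h j - h by rewrite /grid !rmorphD/= !rmorphN/=; ring.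
by rewrite !beta_jordan; field; rewrite gt_eqF.
Qed.

Lemma grid_weights_le (h : R) (M : nat) (i : int) : 0 < h ->
  \sum_(j < M.*2.+1) `|h * Dgrid h beta (i - @idx M j)| <= V.
Proof.
move=> h0.
have hp := cdf_weights np h (grid h i) M h0.
have hn := cdf_weights nn h (grid h i) M h0.
apply: le_trans (lerD hp hn); rewrite -big_split/=; apply: ler_sum => j _.
rewrite grid_weightE//; apply: le_trans (ler_normB _ _) _.
have mono (nu : {finite_measure set (measurableTypeR R) -> \bar R}) :
    0 <= 2^-1 * (fine (nu `]-oo, (grid h i - grid h (idx j) + h)]%classic) -
                 fine (nu `]-oo, (grid h i - grid h (idx j) - h)]%classic)).
  by rewrite mulr_ge0// subr_ge0; apply: (cdf_mono nu); lra.
by rewrite !ger0_norm ?mono.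
Qed.

Lemma convolution_increment (g : R -> R) (G L x delta : R) : 0 < delta -> continuous g ->
  (forall y, `|g y| <= G) ->
  convolution beta g (x + delta) - convolution beta g x =
  \int[leb]_y ((Bp (x + delta - y) - Bp (x - y)) * g y) -
  \int[leb]_y ((Bn (x + delta - y) - Bn (x - y)) * g y).
Proof.
move=> delta0 cg gG.
have ic z : leb.-integrable [set: R] (EFin \o (fun y => beta (z - y) * g y)).
  have ib := integrable_reflect z _ ibeta.
  have G0 : 0 <= G by exact: le_trans (gG 0).
  apply: (integrable_dominated _ (fun y => G * `|beta (z - y)|) _ measurableT).
  - apply: measurable_funM; first exact: (integrable_measurable _ ib).
    exact: continuous_measurable_fun.
  - exact: (integrable_scale _ _ _ _ _ _ measurableT (integrable_norm_fun _ _ _ _ _ ib)).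
  - by move=> y _; rewrite normrM mulrC ler_wpM2r.
have [ip _] := kernel_fubini np g G x delta gG cg delta0.
have [im _] := kernel_fubini nn g G x delta gG cg delta0.
rewrite -(RintegralB measurableT ip im) /convolution -(RintegralB measurableT (ic _) (ic _)).
by apply: eq_Rintegral => y _; rewrite !beta_jordan /Bp /Bn; ring.
Qed.

(** The estimate [quotient_vs_sum] passes to the limit delta -> 0 for both parts
    of mu. *)
Lemma convolution_derivative_grid (g : R -> R) (G L eta h : R) (M : nat) (i : int) : 0 < h -> 0 <= eta ->
  continuous g ->
  (forall y, `|g y| <= G) ->
  (forall y z, `|g y - g z| <= L * `|y - z|) ->
  (forall y, M%:R * h <= `|y| -> `|g y| <= eta) ->
  derivable (convolution beta g) (grid h i) 1 ->
  `|derive1 (convolution beta g) (grid h i)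
    - \sum_(j < M.*2.+1) h * Dgrid h beta (i - @idx M j) * g (grid h (idx j))|
  <= V * (L * h + eta).
Proof.
move=> h0 eta0 cg gG gL geta dF.
set x := grid h i; set F := convolution beta g.
have L0 : 0 <= L.
  by have := gL 1 0; rewrite subr0 normr1 mulr1; exact: le_trans.
have V0 := variation_ge0.
have Q delta : 0 < delta ->
  `|delta^-1 * (F (x + delta) - F x)
    - \sum_(j < M.*2.+1) h * Dgrid h beta (i - @idx M j) * g (grid h (idx j))|
  <= V * (L * h + eta) + V * L * delta.
  move=> delta0.
  rewrite /F (convolution_increment g G L)//.
  have hp := quotient_vs_sum np g G L eta x delta h M delta0 h0 eta0 cg gG gL geta.
  have hn := quotient_vs_sum nn g G L eta x delta h M delta0 h0 eta0 cg gG gL geta.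
  rewrite (eq_bigr (fun j : 'I_M.*2.+1 =>
    2^-1 * (Bp (x - grid h (idx j) + h) - Bp (x - grid h (idx j) - h)) * g (grid h (idx j)) -
    2^-1 * (Bn (x - grid h (idx j) + h) - Bn (x - grid h (idx j) - h)) * g (grid h (idx j)))); last first.
    by move=> j _; rewrite grid_weightE// mulrBl.
  rewrite sumrB.
  rewrite (_ : forall a b c d e : R, a * (b - c) - (d - e) = (a * b - d) - (a * c - e)); last by move=> *; ring.
  apply: le_trans (ler_normB _ _) _; apply: le_trans (lerD hp hn) _.
  by rewrite -mulrDr -/V (_ : (_ + _) * V = V * (L * h + eta) + V * L * delta)//; ring.
apply/ler_addgt0Pr => e e0.
have /cvg_ex[l Fl] := dF.
have El : derive1 F x = l.
  rewrite derive1E /derive; apply/cvg_lim => //; exact: Fl.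
have /cvgrPdist_le/(_ _ (divr_gt0 e0 (ltr0n R 2))) := Fl.
rewrite near_withinE => /nbhs_ballP[r /= r0 hr].
pose K : R := V * L + 1.
have K0 : 0 < K by rewrite ltr_wpDl// mulr_ge0.
pose delta : R := Num.min (r / 2) (e / 2 / K).
have delta0 : 0 < delta by rewrite lt_min !divr_gt0.
have dr : delta <= r / 2 by rewrite ge_min lexx.
have de : delta <= e / 2 / K by rewrite ge_min lexx orbT.
have := hr delta; rewrite /ball/= sub0r normrN gtr0_norm// => /(_ _ (lt0r_neq0 delta0)).
rewrite /GRing.scale/= mulr1 [delta + x]addrC => /(_ _)/= h1.
have {}h1 : `|l - delta^-1 * (F (x + delta) - F x)| <= e / 2 by apply: h1; lra.
rewrite El; set S := \sum_(j < _) _.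
have -> : l - S = (l - delta^-1 * (F (x + delta) - F x)) + (delta^-1 * (F (x + delta) - F x) - S) by ring.
apply: le_trans (ler_normD _ _) _; apply: le_trans (lerD h1 (Q _ delta0)) _.
have : V * L * delta <= e / 2.
  apply: (@le_trans _ _ (K * delta)); first by rewrite ler_wpM2r ?(ltW delta0)// lerDl.
  by rewrite mulrC -ler_pdivlMr.
lra.
Qed.

End charge_consistency.

End consistency.

(** * Gronwall inequality *)

Section differential_inequalities.
Context {R : realType}.

(** [comparison] with a linear majorant; r may lie on either side of t. *)
Lemma comparison_sym (e de : R -> R) (c lo hi r t : R) : r \in `[lo, hi] -> t \in `[lo, hi] ->
  {within `[lo, hi], continuous e} ->
  (forall x, x \in `]lo, hi[ -> is_derive x 1 e (de x)) ->
  (forall x, x \in `]lo, hi[ -> `|x - t| <= `|r - t| -> `|de x| <= c) ->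
  `|e r - e t| <= c * `|r - t|.
Proof.
move=> rI tI ce dE dec.
have sub a b : a \in `[lo, hi] -> b \in `[lo, hi] -> {subset `]a, b[ <= `]lo, hi[}.
  move=> aI bI x; move: aI bI; rewrite !in_itv/=; lra.
have cont a b : a \in `[lo, hi] -> b \in `[lo, hi] -> {within `[a, b], continuous e}.
  move=> aI bI; apply: continuous_subspaceW ce => x /=; move: aI bI; rewrite !in_itv/=; lra.
have lin (x : R) : is_derive x 1 (fun y : R => c * y) c.
  by apply: is_derive_eq; rewrite /GRing.scale/=; ring.
have clin : continuous (fun y : R => c * y).
  by move=> x; apply: derivable_continuous_at; apply: ex_derive.
have [tr|rt] := orP (le_total t r).
- rewrite (ger0_norm (_ : 0 <= r - t)) ?subr_ge0// mulrBr.
  have bnd x : x \in `]t, r[ -> `|de x| <= c.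
    move=> xI; apply: dec; first exact: (sub t r).
    by move: xI; rewrite in_itv/= => /andP[? ?]; rewrite !ger0_norm; lra.
  have := (@comparison _ e (fun y : R => c * y) de (fun=> c) t r tr (cont t r tI rI)
    (continuous_subspaceT clin) (fun x xI => dE x (sub t r tI rI x xI)) (fun x _ => lin x) bnd); exact.
- rewrite distrC [`|r - t|]distrC (ger0_norm (_ : 0 <= t - r)) ?subr_ge0// mulrBr.
  have bnd x : x \in `]r, t[ -> `|de x| <= c.
    move=> xI; apply: dec; first exact: (sub r t).
    by move: xI; rewrite in_itv/= => /andP[? ?]; rewrite !ler0_norm; lra.
  have := (@comparison _ e (fun y : R => c * y) de (fun=> c) r t rt (cont r t rI tI)
    (continuous_subspaceT clin) (fun x xI => dE x (sub r t rI tI x xI)) (fun x _ => lin x) bnd); exact.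
Qed.

Section gronwall.
Variables (n : nat) (e de : 'I_n -> R -> R) (T a K : R).
Hypothesis a0 : 0 <= a.
Hypothesis K0 : 0 <= K.
Hypothesis ce : forall i, {within `[0, T], continuous (e i)}.
Hypothesis dE : forall i (t : R), t \in `]0, T[ -> is_derive t 1 (e i) (de i t).
Hypothesis de_le : forall i (t b : R), t \in `]0, T[ -> (forall j, `|e j t| <= b) -> `|de i t| <= a + K * b.
Hypothesis e_start : forall i, e i 0 = 0.

(** Integrating K E exp (2 K t) gives back only half of E exp (2 K t): this is
    what the factor 2 in the exponent is for. *)
Let gronwall_step (E : R) : 0 <= E ->
  (forall i (t : R), t \in `[0, T] -> `|e i t| <= E * expR (2 * K * t)) ->
  (forall i (t : R), t \in `[0, T] -> `|e i t| <= (a * T + E / 2) * expR (2 * K * t)).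
Proof.
move=> E0 hE i t; rewrite in_itv/= => /andP[t0 tT].
pose psi (x : R) := a * x + E / 2 * expR (2 * K * x).
have dpsi (x : R) : is_derive x 1 psi (a + K * (E * expR (2 * K * x))).
  by apply: is_derive_eq; rewrite /GRing.scale/=; field.
have cpsi : continuous psi by move=> x; apply: derivable_continuous_at; apply: ex_derive.
have ci : {within `[0, t], continuous (e i)}.
  by apply: continuous_subspaceW (ce i) => x /=; rewrite !in_itv/=; lra.
have di x : x \in `]0, t[ -> is_derive x 1 (e i) (de i x).
  by move=> xI; apply: dE; move: xI; rewrite !in_itv/=; lra.
have bnd x : x \in `]0, t[ -> `|de i x| <= a + K * (E * expR (2 * K * x)).
  move=> xI; apply: de_le; first by move: xI; rewrite !in_itv/=; lra.
  by move=> j; apply: hE; move: xI; rewrite !in_itv/=; lra.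
have := @comparison _ (e i) psi (de i) _ 0 t t0 ci (continuous_subspaceT cpsi) di (fun x _ => dpsi x) bnd.
rewrite e_start subr0 => /le_trans; apply.
rewrite /psi !mulr0 expR0 add0r mulr1 [leRHS]mulrDl.
have e1 : 1 <= expR (2 * K * t) by rewrite -expR0 ler_expR !mulr_ge0.
have : a * t <= a * T * expR (2 * K * t).
  apply: (@le_trans _ _ (a * T)); first by rewrite ler_wpM2l.
  by rewrite ler_peMr// mulr_ge0// (le_trans t0).
have : 0 <= E / 2 by rewrite divr_ge0.
lra.
Qed.

(** The functions are bounded, since they are continuous on a segment. Iterating
    [gronwall_step] contracts any such bound to its fixed point 2 a T; this way
    the maximum of the |e i|, which need not be differentiable, never has to be
    differentiated. *)
Lemma gronwall i t : t \in `[0, T] -> `|e i t| <= 2 * a * T * expR (2 * K * t).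
Proof.
move=> tT.
have T0 : 0 <= T by move: tT; rewrite in_itv/=; lra.
have hb j : exists M : R, forall r : R, r \in `[0, T] -> `|e j r| <= M by exact: within_continuous_bounded.
have [M hM] := choice hb.
pose E0 : R := \sum_j `|M j|.
have E00 : 0 <= E0 by exact: sumr_ge0.
have step k : forall j t, t \in `[0, T] -> `|e j t| <= (2 * a * T + E0 * 2^-1 ^+ k) * expR (2 * K * t).
  elim: k => [|k IH] j r rT.
    rewrite expr0 mulr1; apply: (@le_trans _ _ (E0 * 1)).
      rewrite mulr1; apply: le_trans (hM j r rT) _; apply: le_trans (ler_norm _) _.
      by rewrite /E0 (bigD1 j)//= lerDl sumr_ge0.
    apply: ler_pM => //; first by rewrite lerDr !mulr_ge0.
    by rewrite -expR0 ler_expR !mulr_ge0//; move: rT; rewrite in_itv/=; lra.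
  have := gronwall_step (2 * a * T + E0 * 2^-1 ^+ k) _ IH j r rT.
  have p0 : 0 <= E0 * 2^-1 ^+ k by rewrite mulr_ge0// exprn_ge0// invr_ge0.
  have -> : a * T + (2 * a * T + E0 * 2^-1 ^+ k) / 2 = 2 * a * T + E0 * 2^-1 ^+ k.+1.
    by rewrite exprSr; field.
  by apply; rewrite addr_ge0// !mulr_ge0.
have hc : (2 * a * T + E0 * 2^-1 ^+ k) * expR (2 * K * t) @[k --> \oo] -->
    (2 * a * T + E0 * 0) * expR (2 * K * t).
  apply: cvgMl; apply: cvgD; first exact: cvg_cst.
  apply: cvgMr; apply: cvg_expr; rewrite ger0_norm ?invr_ge0//.
  by rewrite invf_lt1// ltr1n.
move: hc; rewrite mulr0 addr0 => hc.
by apply: (cvgr_to_ge hc); near=> k; exact: step.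
Unshelve. all: by end_near. Qed.

End gronwall.

End differential_inequalities.

(** * Picard iteration *)

Section grid_convergence.
Context {R : realType}.
Local Notation leb := (@lebesgue_measure R).

Lemma antiderivative (f : R -> R) (T : R) : 0 < T -> {within `[0, T], continuous f} ->
  let F t := \int[leb]_(x in `[0, t]) f x in
  [/\ F 0 = 0, {within `[0, T], continuous F} &
   forall t : R, t \in `]0, T[ -> is_derive t 1 F (f t)].
Proof.
move=> T0 cf F.
have fi : leb.-integrable `[0, T] (EFin \o f).
  by apply: continuous_compact_integrable => //; exact: segment_compact.
split.
- by rewrite /F set_itv1 Rintegral_set1.
- exact: (parameterized_integral_continuous (ltW T0) fi).
- move=> t tI; have ct : {for t, continuous f}.
    by have [h _ _] := (continuous_within_itvP f T0).1 cf; exact: h.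
  move: tI; rewrite in_itv/= => /andP[t0 tT].
  have [dF FE] := continuous_FTC1_closed tT fi t0 ct.
  by apply: DeriveDef; [exact: dF|rewrite -derive1E; exact: FE].
Qed.

Section picard.
Variables (n : nat) (F : 'I_n -> ('I_n -> R) -> R) (G K T : R) (w0 : 'I_n -> R).
Hypothesis T0 : 0 < T.
Hypothesis K0 : 0 <= K.
Hypothesis F_le : forall i x, `|F i x| <= G.
Hypothesis F_lip : forall i x y (b : R), (forall j, `|x j - y j| <= b) -> `|F i x - F i y| <= K * b.

Let G0 (i : 'I_n) : 0 <= G.
Proof. exact: le_trans (F_le i (fun=> 0)). Qed.

Lemma field_cvg (U : Type) (FF : set_system U) {fF : Filter FF} (W : U -> 'I_n -> R) (x : 'I_n -> R) (i : 'I_n) :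
  (forall j, W k j @[k --> FF] --> x j) -> F i (W k) @[k --> FF] --> F i x.
Proof.
move=> h; apply/cvgrPdist_le => eps eps0.
have e0 : 0 < eps / (K + 1) by rewrite divr_gt0// ltr_wpDl.
have H : \forall k \near FF, forall j, `|x j - W k j| <= eps / (K + 1).
  by apply: filter_forall => j; move/cvgrPdist_le: (h j); exact.
apply: filterS H => k hk; apply: le_trans (F_lip i _ _ _ hk) _.
by rewrite mulrCA ger_pMr// ler_pdivrMr ?mul1r ?lerDl// ltr_wpDl.
Qed.

Lemma field_along_curve_continuous (W : 'I_n -> R -> R) (i : 'I_n) :
  (forall j, {within `[0, T], continuous (W j)}) ->
  {within `[0, T], continuous (fun t => F i (W^~ t))}.
Proof.
move=> cW; apply/subspace_continuousP => t tI.
apply: (field_cvg _ _ (fun r j => W j r)) => j.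
by move/subspace_continuousP: (cW j); exact.
Qed.

Fixpoint picard_iterate (k : nat) (i : 'I_n) (t : R) : R :=
  if k is k'.+1 then
    w0 i + \int[leb]_(r in `[0, t]) F i (fun j => picard_iterate k' j r)
  else w0 i.

Local Notation W := picard_iterate.

Lemma picard_iterate_continuous k i : {within `[0, T], continuous (W k i)}.
Proof.
elim: k i => [|k IH] i; first by apply: continuous_subspaceT => x; exact: cvg_cst.
have [_ c _] := antiderivative _ _ T0 (field_along_curve_continuous _ i IH).
rewrite [W k.+1 i](_ : _ = cst (w0 i) \+ (fun t => \int[leb]_(r in `[0, t]) F i ((W k)^~ r)))//.
by move=> x; apply: continuousD; [exact: cvg_cst|exact: c].
Qed.

Lemma picard_iterate0 k i : W k i 0 = w0 i.
Proof. by case: k => [|k] //=; rewrite set_itv1 Rintegral_set1 addr0. Qed.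

Lemma picard_iterate_derive k i (t : R) : t \in `]0, T[ ->
  is_derive t 1 (W k.+1 i) (F i ((W k)^~ t)).
Proof.
move=> tI.
have [_ _ d] := antiderivative _ _ T0 (field_along_curve_continuous _ i (picard_iterate_continuous k)).
have := @is_deriveD _ _ _ (cst (w0 i)) _ t 1 0 _ (is_derive_cst _ _ _) (d t tI).
by rewrite add0r.
Qed.

Lemma picard_iterate_lipschitz k i (r t : R) : r \in `[0, T] -> t \in `[0, T] ->
  `|W k i r - W k i t| <= G * `|r - t|.
Proof.
case: k => [|k] rI tI; first by rewrite /= subrr normr0 mulr_ge0// (G0 i).
by apply: (comparison_sym _ _ _ _ _ _ _ rI tI (picard_iterate_continuous k.+1 i)
  (fun x xI => picard_iterate_derive k i x xI)) => x _ _.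
Qed.

(** A tangency of second order with a constant independent of k. It survives the
    pointwise limit and gives the derivative of the limit, one-sided at the ends
    of [0, T]. *)
Lemma picard_iterate_tangent k i (r t : R) : r \in `[0, T] -> t \in `[0, T] ->
  `|W k.+2 i r - W k.+2 i t - (r - t) * F i ((W k.+1)^~ t)| <= K * G * `|r - t| ^+ 2.
Proof.
move=> rI tI; set c := F i _.
pose e (x : R) := W k.+2 i x - x * c.
have lin (x : R) : is_derive x 1 (fun y : R => y * c) c.
  by apply: is_derive_eq; rewrite /GRing.scale/=; ring.
have clin : continuous (fun y : R => y * c).
  by move=> x; apply: derivable_continuous_at; apply: ex_derive.
have ce : {within `[0, T], continuous e}.
  move=> x; apply: continuousB; first exact: picard_iterate_continuous.
  exact: (continuous_subspaceT clin).
have de x : x \in `]0, T[ -> is_derive x 1 e (F i ((W k.+1)^~ x) - c).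
  by move=> xI; have := picard_iterate_derive k.+1 i x xI => d; exact: is_deriveB.
have bnd x : x \in `]0, T[ -> `|x - t| <= `|r - t| -> `|F i ((W k.+1)^~ x) - c| <= K * G * `|r - t|.
  move=> xI xt; rewrite -mulrA; apply: F_lip => j.
  apply: le_trans (picard_iterate_lipschitz k.+1 j x t _ tI) _.
    by move: xI; rewrite !in_itv/=; lra.
  by rewrite ler_wpM2l// (G0 i).
have := comparison_sym _ _ _ _ _ _ _ rI tI ce de bnd.
rewrite expr2 mulrA; congr (`|_| <= _); rewrite /e; ring.
Qed.

(** As in [gronwall_step], the weight exp (2 K t) makes the gaps shrink by a
    factor 2 at every step, whatever the length of [0, T]. *)
Lemma picard_gap k i (t : R) : t \in `[0, T] ->
  `|W k.+1 i t - W k i t| <= G * T * expR (2 * K * t) * 2^-1 ^+ k.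
Proof.
elim: k i t => [|k IH] i t tI.
  have := picard_iterate_lipschitz 1 i t 0 tI.
  rewrite picard_iterate0 subr0 => /(_ _)/le_trans; apply.
    by rewrite in_itv/= lexx ltW.
  move: tI; rewrite in_itv/= => /andP[t0 tT].
  rewrite expr0 mulr1 ger0_norm//; apply: (@le_trans _ _ (G * T)).
    by rewrite ler_wpM2l// (G0 i).
  rewrite ler_peMr//; first by rewrite mulr_ge0 ?(G0 i) ?ltW.
  by rewrite -expR0 ler_expR !mulr_ge0.
move: (tI); rewrite in_itv/= => /andP[t0 tT].
pose A := G * T * 2^-1 ^+ k.
pose psi (x : R) := A / 2 * expR (2 * K * x).
have dpsi (x : R) : is_derive x 1 psi (K * (A * expR (2 * K * x))).
  by apply: is_derive_eq; rewrite /GRing.scale/=; field.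
have cpsi : continuous psi by move=> x; apply: derivable_continuous_at; apply: ex_derive.
pose e (x : R) := W k.+2 i x - W k.+1 i x.
have ce : {within `[0, t], continuous e}.
  apply: (@continuous_subspaceW _ _ _ `[0, T]); first by move=> x /=; rewrite !in_itv/=; lra.
  by move=> x; apply: continuousB; exact: picard_iterate_continuous.
have de x : x \in `]0, t[ -> is_derive x 1 e (F i ((W k.+1)^~ x) - F i ((W k)^~ x)).
  move=> xI; have xT : x \in `]0, T[ by move: xI; rewrite !in_itv/=; lra.
  have := picard_iterate_derive k.+1 i x xT; have := picard_iterate_derive k i x xT => d d'.
  exact: is_deriveB.
have bnd x : x \in `]0, t[ -> `|F i ((W k.+1)^~ x) - F i ((W k)^~ x)| <= K * (A * expR (2 * K * x)).
  move=> xI; apply: F_lip => j.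
  have -> : A * expR (2 * K * x) = G * T * expR (2 * K * x) * 2^-1 ^+ k by rewrite /A; ring.
  by apply: IH; move: xI; rewrite !in_itv/=; lra.
have := @comparison _ e psi _ _ 0 t t0 ce (continuous_subspaceT cpsi) de (fun x _ => dpsi x) bnd.
have -> : e 0 = 0 by rewrite /e !picard_iterate0 subrr.
rewrite subr0 => /le_trans; apply.
have A0 : 0 <= A by rewrite !mulr_ge0 ?(G0 i) ?ltW// exprn_gt0.
apply: (@le_trans _ _ (psi t)).
  by rewrite gerBl /psi mulr_ge0 ?divr_ge0// expR_ge0.
by rewrite /psi /A exprSr le_eqVlt; apply/orP; left; apply/eqP; ring.
Qed.

Lemma picard_iterate_cvg i (t : R) : t \in `[0, T] -> cvgn (fun k => W k i t).
Proof.
move=> tI; pose u k := W k.+1 i t - W k i t.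
have cu : cvgn (series u).
  apply: normed_cvg; apply: (series_le_cvg (v_ := geometric (G * T * expR (2 * K * t)) 2^-1)).
  - by move=> k; exact: normr_ge0.
  - move=> k; rewrite /geometric/= !mulr_ge0 ?(G0 i) ?expR_ge0 ?ltW// ?exprn_gt0//.
  - by move=> k; exact: picard_gap.
  - apply: is_cvg_geometric_series; rewrite ger0_norm ?invr_ge0//.
    by rewrite invf_lt1// ltr1n.
have -> : (fun k => W k i t) = (fun k => series u k + w0 i).
  by apply/funext => k; rewrite /series/= telescope_sumr// subrK.
by apply: is_cvgD => //; exact: is_cvg_cst.
Qed.

Lemma picard : exists w : 'I_n -> R -> R, (forall i, w i 0 = w0 i) /\
  forall i t, t \in `[0, T] ->
    (r - t)^-1 * (w i r - w i t) @[r --> within `[0, T] t^'] --> F i (w^~ t).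
Proof.
pose w i t := lim (W k i t @[k --> \oo]).
have cw i t : t \in `[0, T] -> W k i t @[k --> \oo] --> w i t by move=> tI; exact: picard_iterate_cvg.
exists w; split => [i|i t tI].
  rewrite /w (_ : (fun k => W k i 0) = fun=> w0 i) ?lim_cst//.
  by apply/funext => k; rewrite picard_iterate0.
have tangent r : r \in `[0, T] -> `|w i r - w i t - (r - t) * F i (w^~ t)| <= K * G * `|r - t| ^+ 2.
  move=> rI.
  have h : `|W k.+2 i r - W k.+2 i t - (r - t) * F i ((W k.+1)^~ t)| @[k --> \oo] -->
    `|w i r - w i t - (r - t) * F i (w^~ t)|.
    apply: cvg_norm; apply: cvgB; first apply: cvgB.
    - have := cw i r rI; rewrite -(cvg_shiftn 2); under eq_fun do rewrite addn2; exact.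
    - have := cw i t tI; rewrite -(cvg_shiftn 2); under eq_fun do rewrite addn2; exact.
    - apply: cvgMr; apply: (field_cvg _ _ (fun k j => W k.+1 j t)) => j.
      by have := cw j t tI; rewrite -(cvg_shiftn 1); under eq_fun do rewrite addn1; exact.
  by apply: (cvgr_to_le h); near=> k; exact: picard_iterate_tangent.
apply/cvgrPdist_le => eps eps0.
have C0 : 0 <= K * G by rewrite mulr_ge0 ?(G0 i).
have d0 : 0 < eps / (K * G + 1) by rewrite divr_gt0// ltr_wpDl.
have : \forall r \near t, `|t - r| < eps / (K * G + 1) by exact: nbhsx_ballx.
rewrite !near_withinE; apply: filterS => r; rewrite distrC => /ltW rtd rt rI.
have rt0 : 0 < `|r - t| by rewrite normr_gt0 subr_eq0.
rewrite -(ler_pM2l rt0) -normrM mulrBr mulVKf ?subr_eq0// distrC.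
apply: le_trans (tangent r rI) _.
rewrite expr2 mulrCA ler_pM2l//.
apply: (@le_trans _ _ (K * G * (eps / (K * G + 1)))).
  by rewrite ler_wpM2l//.
by rewrite mulrCA ger_pMr// ler_pdivrMr ?mul1r ?lerDl// ltr_wpDl.
Unshelve. all: by end_near. Qed.

End picard.

(** * One-sided time derivatives *)

(** The form of differentiability in which the solutions are given: on the segment
    [0, T], hence one-sided at its ends. *)
Definition has_time_derivative (T : R) (e de : R -> R) : Prop :=
  forall t, t \in `[0, T] ->
    (r - t)^-1 * (e r - e t) @[r --> within `[0, T] t^'] --> de t.

Lemma has_time_derivative_continuous (T : R) (e de : R -> R) :
  has_time_derivative T e de -> {within `[0, T], continuous e}.
Proof.
move=> h; apply/subspace_continuousP => t tI.
apply/cvgrPdist_le => eps eps0.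
have d0 : 0 < eps / (`|de t| + 1) by rewrite divr_gt0// ltr_wpDl.
have h1 : \forall r \near t, `|t - r| < eps / (`|de t| + 1) by exact: nbhsx_ballx.
have := h t tI; move=> /cvgrPdist_le/(_ _ ltr01); rewrite !near_withinE.
apply: filterS2 h1 => r h1 h2 rI.
have [->|rt] := eqVneq r t; first by rewrite subrr normr0 ltW.
have {}h2 := h2 rt rI.
have rt0 : r - t != 0 by rewrite subr_eq0.
have q : `|(r - t)^-1 * (e r - e t)| <= `|de t| + 1.
  apply: le_trans (lerD (lexx `|de t|) h2).
  by rewrite -lerBlDl; apply: le_trans (lerB_dist _ _) _; rewrite distrC.
rewrite distrC -[e r - e t](mulVKf rt0) normrM.
apply: (@le_trans _ _ (eps / (`|de t| + 1) * (`|de t| + 1))).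
  by apply: ler_pM => //; rewrite distrC ltW.
by rewrite mulfVK// gt_eqF// ltr_wpDl.
Qed.

Lemma has_time_derivative_is_derive (T : R) (e de : R -> R) (t : R) :
  has_time_derivative T e de -> t \in `]0, T[ -> is_derive t 1 e (de t).
Proof.
move=> h tI.
have tI' : t \in `[0, T] by move: tI; rewrite !in_itv/=; lra.
have H : (r^-1 *: (e (r *: 1 + t) - e t)) @[r --> 0^'] --> de t.
  apply/cvgrPdist_le => eps eps0.
  have := h t tI'; move=> /cvgrPdist_le/(_ _ eps0); rewrite !near_withinE => h1.
  have h2 := near_in_itvoo tI.
  have sh : (r *: 1 + t : R) @[r --> (0 : R)] --> t.
    rewrite -[X in _ --> X]add0r -[X in _ --> X + t](scale0r (1 : R)).
    by apply: cvgD; [apply: cvgZl; exact: cvg_id|exact: cvg_cst].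
  have h3 : \forall r \near t, (r != t -> `|de t - (r - t)^-1 * (e r - e t)| <= eps).
    apply: filterS2 h1 h2 => r h1 h2 rt; apply: h1 => //=.
    by move: h2; rewrite !in_itv/=; lra.
  have h4 : \forall r \near (0 : R), (r *: 1 + t != t ->
      `|de t - (r *: 1 + t - t)^-1 * (e (r *: 1 + t) - e t)| <= eps) := sh _ h3.
  apply: filterS h4 => r h4 r0.
  move: h4; rewrite addrK /GRing.scale/= mulr1; apply.
  by rewrite -subr_eq0 addrK.
by apply: DeriveDef; [apply/cvg_ex; exists (de t)|exact: cvg_lim H].
Qed.

Lemma has_time_derivativeB (T : R) (e e' de de' : R -> R) :
  has_time_derivative T e de -> has_time_derivative T e' de' ->
  has_time_derivative T (fun t => e t - e' t) (fun t => de t - de' t).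
Proof.
move=> h h' t tI.
rewrite (_ : (fun r => _) = (fun r => (r - t)^-1 * (e r - e t)) \- (fun r => (r - t)^-1 * (e' r - e' t))).
  exact: cvgB (h t tI) (h' t tI).
by apply/funext => r /=; rewrite -mulrBr; congr (_ * _); ring.
Qed.

(** * Truncation of the nonlinearity *)

Definition clamp (A x : R) : R := Num.max (- A) (Num.min A x).

Lemma clampP (A x : R) : 0 <= A ->
  [\/ x <= - A /\ clamp A x = - A, A <= x /\ clamp A x = A |
      (- A <= x <= A) /\ clamp A x = x].
Proof.
move=> A0; rewrite /clamp.
have [Ax|xA] := orP (le_total A x).
  by apply: Or32; rewrite (min_idPl Ax) (max_idPr _)//; lra.
rewrite (min_idPr xA); have [h|h] := orP (le_total x (- A)).
  by apply: Or31; rewrite (max_idPl h).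
by apply: Or33; rewrite (max_idPr h) h xA.
Qed.

Lemma clamp_le (A x : R) : 0 <= A -> `|clamp A x| <= A.
Proof. by move=> A0; rewrite ler_norml; case: (clampP A x A0) => -[? ->]; lra. Qed.

Lemma clamp_id (A x : R) : `|x| <= A -> clamp A x = x.
Proof.
move=> xA; have A0 : 0 <= A by apply: le_trans xA.
by move: xA; rewrite ler_norml; case: (clampP A x A0) => -[? ->]; lra.
Qed.

Lemma clamp_lipschitz (A x y : R) : 0 <= A -> `|clamp A x - clamp A y| <= `|x - y|.
Proof.
move=> A0.
wlog yx : x y / y <= x => [hw|].
  have [yx|xy] := orP (le_total y x); first exact: hw.
  by rewrite distrC [`|x - y|]distrC; exact: hw.
rewrite (ger0_norm (_ : 0 <= x - y)) ?subr_ge0// ler_norml.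
by case: (clampP A x A0) => -[? ->]; case: (clampP A y A0) => -[? ->]; lra.
Qed.

Lemma Ck2_lipschitz (k : nat) (f : R -> R) (A : R) : (2 <= k)%N -> Ck k f ->
  exists2 L, 0 < L & forall x y, `|x| <= A -> `|y| <= A -> `|f x - f y| <= L * `|x - y|.
Proof.
move=> k2 [df _].
have df0 x : derivable f x 1 by apply: (df 0%N); exact: leq_trans k2.
have df1 x : derivable (derive1 f) x 1 by exact: (df 1%N).
have [M hM] := within_continuous_bounded (derive1 f) (- A) A
  (continuous_subspaceT (fun x => derivable_continuous_at _ _ (df1 x))).
exists (`|M| + 1); first by rewrite ltr_wpDl.
move=> x y xA yA.
have inI z : `|z| <= A -> z \in `[- A, A] by rewrite in_itv/= ler_norml.
have cf : {within `[- A, A], continuous f}.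
  by apply: continuous_subspaceT => z; exact: derivable_continuous_at.
have dE z : z \in `]- A, A[ -> is_derive z 1 f (derive1 f z).
  by move=> _; apply: DeriveDef; [exact: df0|rewrite derive1E].
apply: (comparison_sym _ _ _ _ _ _ _ (inI x xA) (inI y yA) cf dE) => z zI _.
apply: le_trans (hM z _) _; first by move: zI; rewrite /= !in_itv/=; lra.
by apply: le_trans (ler_norm _) _; rewrite lerDl.
Qed.

(** * The finite system *)

Lemma lipschitz_continuous_fun (g : R -> R) (L : R) :
  (forall x y, `|g x - g y| <= L * `|x - y|) -> continuous g.
Proof.
move=> gL x; apply/cvgrPdist_le => eps eps0.
have L1 : 0 < `|L| + 1 by rewrite ltr_wpDl.
have : \forall y \near x, `|x - y| < eps / (`|L| + 1) by apply: nbhsx_ballx; rewrite divr_gt0.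
apply: filterS => y; rewrite ltr_pdivlMr// => /ltW xy; apply: le_trans (gL x y) _.
apply: le_trans xy; rewrite mulrC ler_wpM2l//.
by apply: le_trans (ler_norm _) _; rewrite lerDl.
Qed.

Lemma weighted_sum_le (n : nat) (a z : 'I_n -> R) (V c : R) : 0 <= c ->
  \sum_(j < n) `|a j| <= V -> (forall j, `|z j| <= c) -> `|\sum_(j < n) a j * z j| <= V * c.
Proof.
move=> c0 aV zc; apply: le_trans (ler_norm_sum _ _ _) _.
apply: (@le_trans _ _ (\sum_(j < n) `|a j| * c)).
  by apply: ler_sum => j _; rewrite normrM ler_wpM2l.
by rewrite -mulr_suml ler_wpM2r.
Qed.

Definition grid_field (h : R) (N : nat) (beta f : R -> R) (i : 'I_N.*2.+1) (x : 'I_N.*2.+1 -> R) : R :=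
  - \sum_(j < N.*2.+1) h * Dgrid h beta (idx i - idx j) * f (x j).

Section grid_system.
Variables (beta : R -> R) (mu : {charge set (measurableTypeR R) -> \bar R}).
Hypothesis ibeta : leb.-integrable [set: R] (EFin \o beta).
Hypothesis betaE : forall x : R, (beta x)%:E = mu [set` `]-oo, x]].
Variables (P N : set (measurableTypeR R)) (muPN : hahn_decomposition mu P N).
Local Notation V := (fine (jordan_pos muPN setT) + fine (jordan_neg muPN setT)).

Lemma grid_field_le (h G : R) (M : nat) (f : R -> R) i x : 0 < h ->
  (forall z, `|f z| <= G) -> `|@grid_field h M beta f i x| <= V * G.
Proof.
move=> h0 fG; rewrite /grid_field normrN; apply: weighted_sum_le => //.
  exact: le_trans (fG 0).
exact: grid_weights_le.
Qed.

Lemma grid_fieldB_le (h c : R) (M : nat) (f : R -> R) i x y : 0 < h ->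
  (forall j, `|f (x j) - f (y j)| <= c) ->
  `|@grid_field h M beta f i x - @grid_field h M beta f i y| <= V * c.
Proof.
move=> h0 fc; rewrite /grid_field -opprD normrN -sumrN -big_split/=.
under eq_bigr do rewrite -mulrBr.
apply: weighted_sum_le => //; first exact: le_trans (fc i).
exact: grid_weights_le.
Qed.

Lemma grid_system_solvable (T h L G : R) (M : nat) (f : R -> R) (w0 : 'I_M.*2.+1 -> R) :
  0 < T -> 0 < h -> 0 <= L ->
  (forall x, `|f x| <= G) -> (forall x y, `|f x - f y| <= L * `|x - y|) ->
  exists w, (forall i, w i 0 = w0 i) /\
    forall i, has_time_derivative T (w i) (fun t => @grid_field h M beta f i (w^~ t)).
Proof.
move=> T0 h0 L0 fG fL.
apply: (@picard _ (@grid_field h M beta f) (V * G) (V * L) T w0 T0).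
- by rewrite mulr_ge0// variation_ge0.
- by move=> i x; exact: grid_field_le.
- move=> i x y b xyb; rewrite -mulrA; apply: grid_fieldB_le => // j.
  by apply: le_trans (fL _ _) _; rewrite ler_wpM2l.
Qed.

(** f is Lipschitz on [-A, A] only, so that solutions for the original, not
    truncated, nonlinearity can be compared. *)
Lemma grid_system_unique (T h L A : R) (M : nat) (f : R -> R) (v w : 'I_M.*2.+1 -> R -> R) :
  0 < h -> 0 <= L ->
  (forall x y, `|x| <= A -> `|y| <= A -> `|f x - f y| <= L * `|x - y|) ->
  (forall i t, t \in `[0, T] -> `|v i t| <= A) ->
  (forall i t, t \in `[0, T] -> `|w i t| <= A) ->
  (forall i, v i 0 = w i 0) ->
  (forall i, has_time_derivative T (v i) (fun t => grid_field h M beta f i (v^~ t))) ->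
  (forall i, has_time_derivative T (w i) (fun t => grid_field h M beta f i (w^~ t))) ->
  forall i t, t \in `[0, T] -> v i t = w i t.
Proof.
move=> h0 L0 fL vA wA vw0 dv dw i t tI.
have d j := has_time_derivativeB _ _ _ _ _ (dv j) (dw j).
have := @gronwall _ _ (fun j t => v j t - w j t) _ T 0 (V * L) (lexx 0) _
  (fun j => has_time_derivative_continuous _ _ _ (d j))
  (fun j t => has_time_derivative_is_derive _ _ _ t (d j)) _ _ i t tI.
rewrite mulr0 !mul0r normr_le0 subr_eq0 => H; apply/eqP; apply: H.
- by rewrite mulr_ge0// variation_ge0.
- move=> k r b rI hb; rewrite add0r -mulrA; apply: grid_fieldB_le => // j.
  have rI' : r \in `[0, T] by move: rI; rewrite !in_itv/=; lra.
  by apply: le_trans (fL _ _ (vA j r rI') (wA j r rI')) _; rewrite ler_wpM2l.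
- by move=> j; rewrite vw0 subrr.
Qed.

(** The values of u on the grid satisfy the system up to the defect bounded in
    [convolution_derivative_grid], with f (u t) bounded by L eta outside the
    window. *)
Lemma grid_system_error (T h eta L B G : R) (M : nat) (f : R -> R)
    (u ut : R -> R -> R) (w : 'I_M.*2.+1 -> R -> R) :
  0 < h -> 0 <= eta -> 0 <= L -> 0 <= B -> 0 <= T ->
  f 0 = 0 -> (forall x, `|f x| <= G) -> (forall x y, `|f x - f y| <= L * `|x - y|) ->
  (forall t, t \in `[0, T] -> forall x y, `|u t x - u t y| <= B * `|x - y|) ->
  (forall t, t \in `[0, T] -> forall x, M%:R * h <= `|x| -> `|u t x| <= eta) ->
  (forall x, has_time_derivative T (u^~ x) (ut^~ x)) ->
  (forall t, t \in `]0, T] -> forall x,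
          derivable (convolution beta (f \o u t)) x 1 /\
          ut t x + derive1 (convolution beta (f \o u t)) x = 0) ->
  (forall i, w i 0 = u 0 (grid h (idx i))) ->
  (forall i, has_time_derivative T (w i) (fun t => grid_field h M beta f i (w^~ t))) ->
  forall i t, t \in `[0, T] ->
    `|u t (grid h (idx i)) - w i t| <= 2 * (V * (L * B * h + L * eta)) * T * expR (2 * (V * L) * t).
Proof.
move=> h0 eta0 L0 B0 T0 f0 fG fL uB utail du pde w0 dw i t tI.
have V0 : 0 <= V by exact: variation_ge0.
have d j := has_time_derivativeB _ _ _ _ _ (du (grid h (idx j))) (dw j).
apply: (@gronwall _ _ (fun j t => u t (grid h (idx j)) - w j t) _ T _ (V * L) _ _
  (fun j => has_time_derivative_continuous _ _ _ (d j))
  (fun j t => has_time_derivative_is_derive _ _ _ t (d j)) _ _ i t tI).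
- by rewrite mulr_ge0// addr_ge0// !mulr_ge0// ltW.
- by rewrite mulr_ge0.
- move=> k r b rI hb.
  have rI' : r \in `[0, T] by move: rI; rewrite !in_itv/=; lra.
  have rI'' : r \in `]0, T] by move: rI; rewrite !in_itv/=; lra.
  have [dc /eqP] := pde r rI'' (grid h (idx k)); rewrite addr_eq0 => /eqP ->.
  have gL y z : `|f (u r y) - f (u r z)| <= L * B * `|y - z|.
    by apply: le_trans (fL _ _) _; rewrite -mulrA ler_wpM2l// uB.
  have gtail y : M%:R * h <= `|y| -> `|f (u r y)| <= L * eta.
    move=> hy; have := fL (u r y) 0; rewrite f0 !subr0 => /le_trans; apply.
    by rewrite ler_wpM2l// utail.
  have Leta : 0 <= L * eta by rewrite mulr_ge0.
  have consistency := convolution_derivative_grid beta mu ibeta betaE P N muPN (f \o u r) G (L * B) (L * eta)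
    h M (idx k) h0 Leta (lipschitz_continuous_fun _ _ gL) (fun y => fG (u r y)) gL gtail dc.
  pose U (j : 'I_M.*2.+1) := u r (grid h (idx j)).
  have stability : `|grid_field h M beta f k (w^~ r) - grid_field h M beta f k U| <= V * (L * b).
    apply: grid_fieldB_le => // j; apply: le_trans (fL _ _) _.
    by rewrite ler_wpM2l// distrC; exact: hb.
  move: consistency stability.
  rewrite {2}/grid_field; set X := derive1 _ _; set S := \sum_(j < _) _; set W := grid_field _ _ _ _ _ _.
  rewrite -(mulrA _ L b) => consistency stability.
  have -> : - X - W = - (X - S) - (W - - S) by ring.
  by apply: le_trans (ler_normB _ _) _; rewrite normrN lerD.
- by move=> j; rewrite w0 subrr.
Qed.

End grid_system.

End grid_convergence.

Theorem theorem5p2 (R : realType) (s T : R) (f beta phi : R -> R)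
    (mu : {charge set (measurableTypeR R) -> \bar R}) (u : R -> R -> R)
    (hs : 5 / 2 < s)
    (hT : 0 < T)
    (hf : Ck (Num.truncn s).+1 f)
    (hf0 : f 0 = 0)
    (hbeta1 : lebesgue_measure.-integrable [set: R] (EFin \o beta))
    (hbeta' : distr_derivative beta mu)
    (hbeta : forall x : R, (beta x)%:E = mu [set` `]-oo, x]])
    (hphi : in_Hs s phi)
    (hu : ivp_solution s T f beta phi u) :
  exists h0 eps0 C : R, [/\ 0 < h0, 0 < eps0, 0 < C &
    forall h eps : R, 0 < h <= h0 -> 0 < eps <= eps0 ->
    exists N : nat, [/\ (0 < N)%N,
      exists v : 'I_N.*2.+1 -> R -> R,
        discrete_solution T h f beta phi v &
      forall v : 'I_N.*2.+1 -> R -> R,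
        discrete_solution T h f beta phi v ->
        forall (i : 'I_N.*2.+1) (t : R), t \in `[0, T] ->
          `|u t (grid h (idx i)) - v i t| <= C * (h + eps)]].
Proof.
have s2 : 2 <= s by lra.
have k2 : (2 <= (Num.truncn s).+1)%N by rewrite ltnS truncn_ge_nat; lra.
have [ut [hC pde u0]] := hu.
have [B B0 uB] := C1_Hs_uniform s T u ut s2 hC.
have du x : has_time_derivative T (u^~ x) (ut^~ x).
  by move=> t tI; exact: (C1_Hs_time_derivative s T u ut s2 hC t tI x).
have [P [Q muPQ]] := Hahn_decomposition mu.
pose V := fine (jordan_pos muPQ setT) + fine (jordan_neg muPQ setT).
have V0 : 0 <= V by exact: variation_ge0.
pose A := B + 1.
have A0 : 0 <= A by rewrite addr_ge0// ltW.
have [L L0 fL] := Ck2_lipschitz _ f A k2 hf.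
(* The truncated nonlinearity agrees with f on the range of u, with a margin 1. *)
pose g := f \o clamp A.
have gL x y : `|g x - g y| <= L * `|x - y|.
  apply: le_trans (fL _ _ (clamp_le A x A0) (clamp_le A y A0)) _.
  by rewrite ler_wpM2l ?clamp_lipschitz// ltW.
have g0 : g 0 = 0 by rewrite /g/= clamp_id ?normr0.
have gA x : `|g x| <= L * A.
  have := fL (clamp A x) 0; rewrite normr0 hf0 !subr0 => /(_ (clamp_le A x A0) A0)/le_trans; apply.
  by rewrite ler_wpM2l ?clamp_le// ltW.
have gu t : t \in `[0, T] -> g \o u t = f \o u t.
  move=> tI; apply/funext => x; rewrite /g/= clamp_id//.
  by have [h _] := uB t tI; apply: le_trans (h x) _; rewrite lerDl.
pose E := expR (2 * (V * L) * T).
pose C := 2 * (V * L) * (B + 1) * T * E + 1.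
have VL0 : 0 <= V * L by rewrite mulr_ge0// ltW.
have C0 : 0 < C by rewrite ltr_wpDl// !mulr_ge0 ?expR_ge0// ltW.
have C2 : 0 < (2 * C)^-1 by rewrite invr_gt0 mulr_gt0.
(* This ensures C (h + eps) <= 1, the margin left by the truncation. *)
exists (2 * C)^-1, (2 * C)^-1, C; split => // h eps /andP[h0 hle] /andP[eps0 epsle].
have [R0 R00 utail] := C1_Hs_vanishes s T u ut s2 hC eps eps0.
pose N := (Num.truncn (R0 / h)).+1.
have NR : R0 <= N%:R * h.
  by rewrite -ler_pdivrMr// ltW// truncnS_gt.
have small : C * (h + eps) <= 1.
  apply: (@le_trans _ _ (C * ((2 * C)^-1 + (2 * C)^-1))); first by rewrite ler_pM2l// lerD.
  by rewrite le_eqVlt; apply/orP; left; apply/eqP; field; rewrite gt_eqF.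
have [w [w0 dw]] := grid_system_solvable beta mu hbeta P Q muPQ T h L (L * A) N g
  (fun i => phi (grid h (idx i))) hT h0 (ltW L0) gA gL.
have err i t : t \in `[0, T] -> `|u t (grid h (idx i)) - w i t| <= C * (h + eps).
  move=> tI.
  have uL r : r \in `[0, T] -> forall x y, `|u r x - u r y| <= B * `|x - y|.
    by move=> rI; have [] := uB r rI.
  have ut0 r : r \in `[0, T] -> forall x, N%:R * h <= `|x| -> `|u r x| <= eps.
    by move=> rI x hx; apply: utail => //; exact: le_trans hx.
  have pde' r : r \in `]0, T] -> forall x, derivable (convolution beta (g \o u r)) x 1 /\
          ut r x + derive1 (convolution beta (g \o u r)) x = 0.
    by move=> rI; rewrite gu; [exact: pde|move: rI; rewrite !in_itv/=; lra].
  have w0' j : w j 0 = u 0 (grid h (idx j)) by rewrite w0 u0.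
  have := grid_system_error beta mu hbeta1 hbeta P Q muPQ T h eps L B (L * A) N g u ut w
    h0 (ltW eps0) (ltW L0) (ltW B0) (ltW hT) g0 gA gL uL ut0 du pde' w0' dw i t tI.
  move=> /le_trans; apply; rewrite -/V.
  have tT : expR (2 * (V * L) * t) <= E.
    have VL2 : 0 <= 2 * (V * L) by rewrite mulr_ge0.
    by move: tI; rewrite in_itv/= ler_expR => /andP[_ tT]; exact: ler_wpM2l.
  apply: (@le_trans _ _ (2 * (V * (L * B * h + L * eps)) * T * E)).
    by rewrite ler_wpM2l// !mulr_ge0// ?addr_ge0// ?mulr_ge0// ltW.
  have p2 : 0 <= V * L * T * E * h by rewrite !mulr_ge0// ?expR_ge0// ltW.
  have p3 : 0 <= V * L * T * E * B * eps by rewrite !mulr_ge0// ?expR_ge0// ltW.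
  have -> : C * (h + eps) = 2 * (V * (L * B * h + L * eps)) * T * E +
    (2 * (V * L * T * E * h) + 2 * (V * L * T * E * B * eps) + (h + eps)) by rewrite /C; ring.
  by clear -p2 p3 h0 eps0; lra.
have wA i t : t \in `[0, T] -> `|w i t| <= A.
  move=> tI; have [hB _] := uB t tI.
  have -> : w i t = u t (grid h (idx i)) - (u t (grid h (idx i)) - w i t) by rewrite subKr.
  by apply: le_trans (ler_normB _ _) _; rewrite lerD// (le_trans (err i t tI)).
have dwf i : has_time_derivative T (w i) (fun t => grid_field h N beta f i (w^~ t)).
  move=> t tI; rewrite (_ : grid_field h N beta f i _ = grid_field h N beta g i (w^~ t)); first exact: dw.
  by rewrite /grid_field; congr (- _); apply: eq_bigr => j _; rewrite /g/= clamp_id// wA.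
exists N; split => //; first by exists w; split.
move=> v [v0 dv] i t tI; rewrite -[v i t](_ : w i t = _); first exact: err.
have hb j : exists b : R, forall r, r \in `[0, T] -> `|v j r| <= b.
  by apply: within_continuous_bounded; apply: has_time_derivative_continuous (dv j).
have [b hbv] := choice hb.
(* The range of v is only known to be bounded: it and that of w lie in some
   [-A', A'], where f has a Lipschitz constant L'. *)
pose A' := A + \sum_j `|b j|.
have vA' j r : r \in `[0, T] -> `|v j r| <= A'.
  move=> rI; apply: le_trans (hbv j r rI) _; apply: le_trans (ler_norm _) _.
  by rewrite /A' (bigD1 j)//= addrCA lerDl addr_ge0// sumr_ge0.
have wA' j r : r \in `[0, T] -> `|w j r| <= A'.
  by move=> rI; apply: le_trans (wA j r rI) _; rewrite lerDl sumr_ge0.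
have [L' L'0 fL'] := Ck2_lipschitz _ f A' k2 hf.
apply: (grid_system_unique beta mu hbeta P Q muPQ T h L' A' N f w v h0 (ltW L'0) fL' wA' vA' _ dwf dv) => //.
by move=> j; rewrite v0 w0.
Qed.
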